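(* Let $k$ be a field of characteristic $0$ and let $\Theta$ be the variety of all power associative linear algebras over $k$. Let $\mathfrak{A}$ be the group of all automorphisms of the category $\Theta^0$ of finitely generated free algebras of $\Theta$, and let $\mathfrak{Y}$ be the normal subgroup of all inner automorphisms. Then $$\mathfrak{A}/\mathfrak{Y}\;\cong\; k^{\ast}\rtimes \mathrm{Aut}\,k ,$$ where $k^{\ast}$ is the multiplicative group of $k$ (the normal factor), $\mathrm{Aut}\,k$ is the group of all field automorphisms of $k$, and $\mathrm{Aut}\,k$ acts on $k^{\ast}$ in the natural way, $a\mapsto \varphi(a)$.
   Context: A linear algebra over $k$ is a $k$-vector space with a $k$-bilinear multiplication (not assumed associative, commutative or unital). It is regarded as a one-sorted universal algebra with operations $0$, $+$, $\cdot$, and one unary operation $h\mapsto\lambda h$ for each $\lambda\in k$; homomorphisms are $k$-linear multiplicative maps. A linear algebra is power associative if it satisfies the identities $x(x^2)=(x^2)x$, $x(x(x^2))=x((x^2)x)=(x(x^2))x=((x^2)x)x=(x^2)(x^2)$, and so on, i.e. for every $n$ all bracketings of the $n$-th power of $x$ coincide (every subalgebra generated by one element is associative). Fix a countable set $X_0=\{x_1,x_2,\ldots\}$. The category $\Theta^0$ has as objects the free algebras $F(X)$ of $\Theta$ generated by finite subsets $X\subset X_0$, and as morphisms all homomorphisms between them. An automorphism of a category $\mathfrak{K}$ is an invertible functor $\mathfrak{K}\to\mathfrak{K}$; an automorphism $\Upsilon$ is inner if it is isomorphic as a functor to the identity functor, i.e. for each object $A$ there is an isomorphism $s_A:A\to\Upsilon(A)$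 with $\Upsilon(\psi)s_A=s_B\psi$ for every morphism $\psi:A\to B$. *)

(* Defs.v *)
From HB Require Import structures.
From mathcomp Require Import all_boot all_order all_algebra finmap.
From mathcomp Require Import boolp.

Set Implicit Arguments.
Unset Strict Implicit.
Unset Printing Implicit Defensive.

Import GRing.Theory.

Local Open Scope quotient_scope.
Local Open Scope group_scope.

Definition isomorphic_groups (G H : groupType) : Prop :=
  exists f : {multiplicative G -> H}, bijective f.

(* The two-sided inverse is stored; being unique, it does not affect
   equality of units (see [unit_inj]). *)
Record units_of (M : monoidType) := UnitOf {
  unit_val :> M;
  unit_inv : M;
  unit_valV : unit_val * unit_inv = 1;
  unit_Vval : unit_inv * unit_val = 1
}.

Section Units.
Variable M : monoidType.
Implicit Types x y z : units_of M.

Lemma unit_inj x y : unit_val x = unit_val y -> x = y.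
Proof.
case: x y => [x x' xx' x'x] [y y' yy' y'y] /= exy; subst y.
have exy' : x' = y' by rewrite -[x']mulg1 -yy' mulgA x'x mul1g.
by subst y'; congr UnitOf; exact: Prop_irrelevance.
Qed.

HB.instance Definition _ := gen_eqMixin (units_of M).
HB.instance Definition _ := gen_choiceMixin (units_of M).

Definition unit_one : units_of M := @UnitOf M 1 1 (mulg1 1) (mulg1 1).

Definition unit_mul x y : units_of M.
Proof.
apply: (@UnitOf M (unit_val x * unit_val y) (unit_inv y * unit_inv x)).
- by rewrite -mulgA (mulgA (unit_val y)) unit_valV mul1g unit_valV.
- by rewrite -mulgA (mulgA (unit_inv x)) unit_Vval mul1g unit_Vval.
Defined.

Definition unit_invg x : units_of M := UnitOf (unit_Vval x) (unit_valV x).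

Fact unit_mulA : associative unit_mul.
Proof. by move=> x y z; apply: unit_inj => /=; rewrite mulgA. Qed.
Fact unit_mul1 : left_id unit_one unit_mul.
Proof. by move=> x; apply: unit_inj => /=; rewrite mul1g. Qed.
Fact unit_1mul : right_id unit_one unit_mul.
Proof. by move=> x; apply: unit_inj => /=; rewrite mulg1. Qed.
Fact unit_mulV : left_inverse unit_one unit_invg unit_mul.
Proof. by move=> x; apply: unit_inj => /=; rewrite unit_Vval. Qed.
Fact unit_Vmul : right_inverse unit_one unit_invg unit_mul.
Proof. by move=> x; apply: unit_inj => /=; rewrite unit_valV. Qed.

HB.instance Definition _ := isGroup.Build (units_of M)
  unit_mulA unit_mul1 unit_1mul unit_mulV unit_Vmul.

End Units.

Record normal_subgroup (G : groupType) := NormalSubgroup {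
  nsub :> {pred G};
  nsub_group : group_closed nsub;
  nsub_normal : forall x y : G, x \in nsub -> x ^ y \in nsub
}.

Section Quotient.
Variables (G : groupType) (N : normal_subgroup G).
Implicit Types x y z : G.

Definition coset_rel : rel G := fun x y => x^-1 * y \in nsub N.

Let N1 : 1 \in nsub N. Proof. by case: (nsub_group N). Qed.
Let NF x y : x \in nsub N -> y \in nsub N -> x * y^-1 \in nsub N.
Proof. by case: (nsub_group N) => _; apply. Qed.
Let NV x : x \in nsub N -> x^-1 \in nsub N.
Proof. by move=> Nx; rewrite -[x^-1]mul1g NF. Qed.
Let NM x y : x \in nsub N -> y \in nsub N -> x * y \in nsub N.
Proof. by move=> Nx Ny; rewrite -[y]invgK NF // NV. Qed.

Fact coset_rel_equiv : equiv_class_of coset_rel.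
Proof.
rewrite /coset_rel; split=> [x|x y|y x z] /=.
- by rewrite mulVg.
- by apply/idP/idP => /NV; rewrite invgM invgK.
- move=> xy yz; have := NM xy yz.
  by rewrite mulgA -(mulgA x^-1) mulgV mulg1.
Qed.

Canonical coset_equiv : equiv_rel G := EquivRelPack coset_rel_equiv.

Definition quotient_group := {eq_quot coset_equiv}.
HB.instance Definition _ := Choice.on quotient_group.

Definition coset_proj x : quotient_group := \pi_quotient_group x.

Lemma coset_projP x y : coset_proj x = coset_proj y <-> x^-1 * y \in nsub N.
Proof. by split=> [/eqmodP|h]; [|apply/eqmodP]. Qed.

Lemma coset_proj_surj (a : quotient_group) : exists x, a = coset_proj x.
Proof. by exists (repr a); rewrite /coset_proj reprK. Qed.

Definition quot_one : quotient_group := coset_proj 1.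
Definition quot_mul (a b : quotient_group) := coset_proj (repr a * repr b).
Definition quot_inv (a : quotient_group) := coset_proj (repr a)^-1.

Lemma quot_repr x : x^-1 * repr (coset_proj x) \in nsub N.
Proof. by apply/coset_projP; rewrite /coset_proj reprK. Qed.

Lemma coset_projM x y : quot_mul (coset_proj x) (coset_proj y) = coset_proj (x * y).
Proof.
apply/esym/coset_projP; rewrite invgM.
have := NM (nsub_normal y (quot_repr x)) (quot_repr y).
by rewrite /conjg !mulgA mulgK.
Qed.

Lemma coset_projV x : quot_inv (coset_proj x) = coset_proj x^-1.
Proof.
apply/esym/coset_projP; rewrite invgK.
have := nsub_normal x^-1 (NV (quot_repr x)).
by rewrite /conjg invgM !invgK !mulgA mulgK.
Qed.

Fact quot_mulA : associative quot_mul.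
Proof.
move=> a b c; have [x ->] := coset_proj_surj a.
have [y ->] := coset_proj_surj b; have [z ->] := coset_proj_surj c.
by rewrite !coset_projM mulgA.
Qed.
Fact quot_mul1 : left_id quot_one quot_mul.
Proof. by move=> a; have [x ->] := coset_proj_surj a; rewrite coset_projM mul1g. Qed.
Fact quot_1mul : right_id quot_one quot_mul.
Proof. by move=> a; have [x ->] := coset_proj_surj a; rewrite coset_projM mulg1. Qed.
Fact quot_mulV : left_inverse quot_one quot_inv quot_mul.
Proof.
move=> a; have [x ->] := coset_proj_surj a.
by rewrite coset_projV coset_projM mulVg.
Qed.
Fact quot_Vmul : right_inverse quot_one quot_inv quot_mul.
Proof.
move=> a; have [x ->] := coset_proj_surj a.
by rewrite coset_projV coset_projM mulgV.
Qed.

HB.instance Definition _ := isGroup.Build quotient_group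
  quot_mulA quot_mul1 quot_1mul quot_mulV quot_Vmul.

End Quotient.

Record aut_action (H N : groupType) := AutAction {
  aact :> H -> N -> N;
  aact1 : forall n, aact 1 n = n;
  aactM : forall h g n, aact (h * g) n = aact h (aact g n);
  aact_morph : forall h, {morph aact h : m n / m * n}
}.

(* N ><| H, with (n, h)(m, g) = (n h(m), hg); N is the normal factor. *)
Record semidirect (H N : groupType) (to : aut_action H N) := Semidirect {
  sd_normal : N;
  sd_compl : H
}.

Section SemidirectGroup.
Variables (H N : groupType) (to : aut_action H N).
Local Notation S := (semidirect to).
Implicit Types x y z : S.

HB.instance Definition _ := gen_eqMixin S.
HB.instance Definition _ := gen_choiceMixin S.

Definition sd_one : S := Semidirect to 1 1.
Definition sd_mul x y : S :=
  Semidirect to (sd_normal x * to (sd_compl x) (sd_normal y))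
                (sd_compl x * sd_compl y).
Definition sd_inv x : S :=
  Semidirect to (to (sd_compl x)^-1 (sd_normal x)^-1) (sd_compl x)^-1.

Lemma aact_one h : to h 1 = 1.
Proof. by apply: (mulgI (to h 1)); rewrite -aact_morph !mulg1. Qed.

Fact sd_mulA : associative sd_mul.
Proof.
by move=> x y z; rewrite /sd_mul /= aact_morph aactM !mulgA.
Qed.
Fact sd_mul1 : left_id sd_one sd_mul.
Proof. by case=> n h; rewrite /sd_mul /= aact1 !mul1g. Qed.
Fact sd_1mul : right_id sd_one sd_mul.
Proof. by case=> n h; rewrite /sd_mul /= aact_one !mulg1. Qed.
Fact sd_mulV : left_inverse sd_one sd_inv sd_mul.
Proof.
by case=> n h; rewrite /sd_mul /sd_inv /= -aact_morph !mulVg aact_one.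
Qed.
Fact sd_Vmul : right_inverse sd_one sd_inv sd_mul.
Proof.
by case=> n h; rewrite /sd_mul /sd_inv /= -aactM !mulgV aact1 mulgV.
Qed.

HB.instance Definition _ := isGroup.Build S
  sd_mulA sd_mul1 sd_1mul sd_mulV sd_Vmul.

End SemidirectGroup.

Record category := Category {
  obj : Type;
  hom : obj -> obj -> Type;
  idc : forall A, hom A A;
  comp : forall A B C, hom B C -> hom A B -> hom A C;
  comp_id : forall A B (f : hom A B), comp f (idc A) = f;
  id_comp : forall A B (f : hom A B), comp (idc B) f = f;
  compA : forall A B C D (h : hom C D) (g : hom B C) (f : hom A B),
    comp h (comp g f) = comp (comp h g) f
}.

Record endofunctor (C : category) := Endofunctor {
  fobj :> obj C -> obj C;
  fmor : forall A B, hom A B -> hom (fobj A) (fobj B);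
  fmor_id : forall A, fmor (idc A) = idc (fobj A);
  fmor_comp : forall A B D (g : hom B D) (f : hom A B),
    fmor (comp g f) = comp (fmor g) (fmor f)
}.

Section Automorphisms.
Variable C : category.
Implicit Types F G : endofunctor C.

Definition functor_id : endofunctor C :=
  @Endofunctor C (fun A => A) (fun _ _ f => f)
    (fun=> erefl) (fun _ _ _ _ _ => erefl).

Definition functor_comp F G : endofunctor C.
Proof.
apply: (@Endofunctor C (fun A => F (G A)) (fun _ _ f => fmor F (fmor G f))).
- by move=> A; rewrite !fmor_id.
- by move=> A B D g f; rewrite !fmor_comp.
Defined.

HB.instance Definition _ := gen_eqMixin (endofunctor C).
HB.instance Definition _ := gen_choiceMixin (endofunctor C).

Fact functor_compA : associative functor_comp.
Proof.
by move=> F G K; rewrite /functor_comp /=; congr Endofunctor;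
  exact: Prop_irrelevance.
Qed.
Fact functor_comp1 : left_id functor_id functor_comp.
Proof.
by case=> o m m1 mM; rewrite /functor_comp /=; congr Endofunctor;
  exact: Prop_irrelevance.
Qed.
Fact functor_1comp : right_id functor_id functor_comp.
Proof.
by case=> o m m1 mM; rewrite /functor_comp /=; congr Endofunctor;
  exact: Prop_irrelevance.
Qed.

HB.instance Definition _ := isMonoid.Build (endofunctor C)
  functor_compA functor_comp1 functor_1comp.

Definition category_aut := units_of (endofunctor C).
HB.instance Definition _ := Group.on category_aut.

Definition is_iso (A B : obj C) (f : hom A B) : Prop :=
  exists g : hom B A, comp g f = idc A /\ comp f g = idc B.

Definition natural_iso F G : Prop :=
  exists s : forall A, hom (F A) (G A),
    (forall A, is_iso (s A)) /\
    forall A B (psi : hom A B), comp (fmor G psi) (s A) = comp (s B) (fmor F psi).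

Definition inner (U : category_aut) : Prop :=
  natural_iso functor_id (unit_val U).

Lemma is_iso_id A : is_iso (idc A).
Proof. by exists (idc A); rewrite comp_id. Qed.

Lemma is_iso_comp A B D (g : hom B D) (f : hom A B) :
  is_iso g -> is_iso f -> is_iso (comp g f).
Proof.
move=> [g' [g'g gg']] [f' [f'f ff']]; exists (comp f' g'); split.
- by rewrite -compA (compA g') g'g id_comp.
- by rewrite -compA (compA f) ff' id_comp.
Qed.

Lemma is_iso_fmor F A B (f : hom A B) : is_iso f -> is_iso (fmor F f).
Proof.
move=> [f' [f'f ff']]; exists (fmor F f').
by rewrite -!fmor_comp f'f ff' !fmor_id.
Qed.

Lemma natural_iso_refl F : natural_iso F F.
Proof.
exists (fun A => idc (F A)); split=> [A|A B psi]; first exact: is_iso_id.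
by rewrite comp_id id_comp.
Qed.

Lemma natural_iso_sym F G : natural_iso F G -> natural_iso G F.
Proof.
move=> [s [s_iso s_nat]].
pose t A := projT1 (cid (s_iso A)).
have ts A : comp (t A) (s A) = idc (F A).
  by rewrite /t; case: cid => /= g [].
have st A : comp (s A) (t A) = idc (G A).
  by rewrite /t; case: cid => /= g [].
exists t; split=> [A|A B psi]; first by exists (s A).
by rewrite -[fmor G psi]comp_id -(st A) (compA (fmor G psi)) s_nat !compA ts id_comp.
Qed.

Lemma natural_iso_comp F F' G G' :
  natural_iso F F' -> natural_iso G G' -> natural_iso (F * G) (F' * G').
Proof.
move=> [s [s_iso s_nat]] [t [t_iso t_nat]].
exists (fun A => comp (s (G' A)) (fmor F (t A))); split=> [A|A B psi] /=.
- exact/is_iso_comp/is_iso_fmor.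
- by rewrite compA s_nat -compA -fmor_comp t_nat fmor_comp compA.
Qed.

Lemma inner_group_closed :
  group_closed [pred U : category_aut | `[< inner U >]].
Proof.
split=> [|U V]; rewrite !inE; first exact/asboolP/natural_iso_refl.
move=> /asboolP innU /asboolP innV; apply/asboolP; rewrite /inner /=.
have innVi : natural_iso functor_id (unit_inv V).
  apply: natural_iso_sym.
  have := natural_iso_comp (natural_iso_refl (unit_inv V)) innV.
  by rewrite unit_Vval mulg1.
by have := natural_iso_comp innU innVi; rewrite mulg1.
Qed.

Lemma inner_normal (U V : category_aut) :
  U \in [pred U : category_aut | `[< inner U >]] ->
  U ^ V \in [pred U : category_aut | `[< inner U >]].
Proof.
rewrite !inE => /asboolP innU; apply/asboolP; rewrite /inner /=.
have := natural_iso_comp (natural_iso_refl (unit_inv V))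
  (natural_iso_comp innU (natural_iso_refl (unit_val V))).
by rewrite mul1g unit_Vval.
Qed.

Definition inner_auts : normal_subgroup category_aut :=
  NormalSubgroup inner_group_closed inner_normal.

End Automorphisms.

Definition mult_monoid (k : fieldType) : Type := k.
HB.instance Definition _ (k : fieldType) := Choice.on (mult_monoid k).
HB.instance Definition _ (k : fieldType) :=
  isMonoid.Build (mult_monoid k) (@mulrA k) (@mul1r k) (@mulr1 k).

Definition ring_endo (k : fieldType) : Type := {rmorphism k -> k}.

Section FieldAut.
Variable k : fieldType.

Lemma rmorph_inj (f g : {rmorphism k -> k}) : f =1 g -> f = g.
Proof.
case: f g => [f [[a] [b]]] [g [[a'] [b']]] /= /funext efg; subst g.
by rewrite (Prop_irrelevance a a') (Prop_irrelevance b b').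
Qed.

HB.instance Definition _ := gen_eqMixin (ring_endo k).
HB.instance Definition _ := gen_choiceMixin (ring_endo k).

Definition ring_endo_comp (f g : ring_endo k) : ring_endo k :=
  (f : {rmorphism k -> k}) \o (g : {rmorphism k -> k}).
Definition ring_endo_id : ring_endo k := idfun.

Fact ring_endo_compA : associative ring_endo_comp.
Proof. by move=> f g h; apply: rmorph_inj. Qed.
Fact ring_endo_comp1 : left_id ring_endo_id ring_endo_comp.
Proof. by move=> f; apply: rmorph_inj. Qed.
Fact ring_endo_1comp : right_id ring_endo_id ring_endo_comp.
Proof. by move=> f; apply: rmorph_inj. Qed.

HB.instance Definition _ := isMonoid.Build (ring_endo k)
  ring_endo_compA ring_endo_comp1 ring_endo_1comp.

Definition scalar_group := units_of (mult_monoid k).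
HB.instance Definition _ := Group.on scalar_group.

Definition field_aut := units_of (ring_endo k).
HB.instance Definition _ := Group.on field_aut.

Definition field_aut_fun (phi : field_aut) : {rmorphism k -> k} := unit_val phi.

Definition natural_act (phi : field_aut) (a : scalar_group) : scalar_group.
Proof.
apply: (@UnitOf (mult_monoid k) (field_aut_fun phi (unit_val a))
                                (field_aut_fun phi (unit_inv a))).
- have := congr1 (field_aut_fun phi) (unit_valV a).
  by rewrite [X in X = _]rmorphM [X in _ = X]rmorph1.
- have := congr1 (field_aut_fun phi) (unit_Vval a).
  by rewrite [X in X = _]rmorphM [X in _ = X]rmorph1.
Defined.

Fact natural_act1 a : natural_act 1 a = a.
Proof. exact: unit_inj. Qed.
Fact natural_actM phi psi a :
  natural_act (phi * psi) a = natural_act phi (natural_act psi a).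
Proof. exact: unit_inj. Qed.
Fact natural_act_morph phi : {morph natural_act phi : a b / a * b}.
Proof. by move=> a b; apply: unit_inj; apply: rmorphM. Qed.

Definition natural_action : aut_action field_aut scalar_group :=
  AutAction natural_act1 natural_actM natural_act_morph.

End FieldAut.

Local Open Scope ring_scope.

(* The multiplication of a linear algebra is the [magmaType] product
   [(x * y)%g]. *)
HB.mixin Record Lmodule_Magma_isBilinear (k : fieldType) A
    of GRing.Lmodule k A & Magma A := {
  amulDl : forall x y z : A, ((x + y) * z)%g = (x * z)%g + (y * z)%g;
  amulDr : forall x y z : A, (x * (y + z))%g = (x * y)%g + (x * z)%g;
  amulZl : forall (l : k) (x y : A), ((l *: x) * y)%g = l *: (x * y)%g;
  amulZr : forall (l : k) (x y : A), (x * (l *: y))%g = l *: (x * y)%g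
}.

#[short(type="linearAlgebraType")]
HB.structure Definition LinearAlgebra (k : fieldType) :=
  {A of Lmodule_Magma_isBilinear k A & GRing.Lmodule k A & Magma A}.

Record algebra_hom (k : fieldType) (A B : linearAlgebraType k) := AlgebraHom {
  algebra_hom_fun :> A -> B;
  algebra_hom_linear : linear algebra_hom_fun;
  algebra_homM : {morph algebra_hom_fun : x y / (x * y)%g}
}.

Section AlgebraHom.
Variable k : fieldType.
Implicit Types A B C : linearAlgebraType k.

Lemma algebra_hom_inj A B (f g : algebra_hom A B) : f =1 g -> f = g.
Proof.
case: f g => [f f1 f2] [g g1 g2] /= /funext efg; subst g.
by congr AlgebraHom; exact: Prop_irrelevance.
Qed.

Definition algebra_hom_id A : algebra_hom A A.
Proof. by apply: (@AlgebraHom k A A (fun x => x)) => [l|] x y. Defined.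

Definition algebra_hom_comp A B C (g : algebra_hom B C) (f : algebra_hom A B) :
  algebra_hom A C.
Proof.
apply: (@AlgebraHom k A C (fun x => g (f x))) => [l x y|x y].
- by rewrite !algebra_hom_linear.
- by rewrite !algebra_homM.
Defined.

Lemma algebra_homD A B (f : algebra_hom A B) : {morph f : x y / x + y}.
Proof. by move=> x y; have := algebra_hom_linear f 1 x y; rewrite !scale1r. Qed.

Lemma algebra_hom0 A B (f : algebra_hom A B) : f 0 = 0.
Proof. by apply: (addrI (f 0)); rewrite -algebra_homD !addr0. Qed.

Lemma algebra_homZ A B (f : algebra_hom A B) l x : f (l *: x) = l *: f x.
Proof.
by have := algebra_hom_linear f l x 0; rewrite algebra_hom0 !addr0.
Qed.

End AlgebraHom.

Inductive bracketing := BLeaf | BNode of bracketing & bracketing.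

Fixpoint bracket_size (b : bracketing) : nat :=
  if b is BNode b1 b2 then (bracket_size b1 + bracket_size b2)%N else 1.

Fixpoint bracket_pow (A : magmaType) (b : bracketing) (x : A) : A :=
  if b is BNode b1 b2 then (bracket_pow b1 x * bracket_pow b2 x)%g else x.

Definition power_associative (A : magmaType) : Prop :=
  forall b1 b2 : bracketing, bracket_size b1 = bracket_size b2 ->
  forall x : A, bracket_pow b1 x = bracket_pow b2 x.

Inductive term (k : Type) (V : Type) :=
  | TVar of V
  | TZero
  | TAdd of term k V & term k V
  | TMul of term k V & term k V
  | TScale of k & term k V.
Arguments TVar {k V}.
Arguments TZero {k V}.

Fixpoint eval (k : fieldType) (V : Type) (A : linearAlgebraType k) (v : V -> A)
    (t : term k V) : A :=
  match t with
  | TVar i => v i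
  | TZero => 0
  | TAdd t1 t2 => eval v t1 + eval v t2
  | TMul t1 t2 => (eval v t1 * eval v t2)%g
  | TScale l t1 => l *: eval v t1
  end.

Section FreePowerAssociative.
Variables (k : fieldType) (V : Type).
Local Notation term := (term k V).

HB.instance Definition _ := gen_eqMixin term.
HB.instance Definition _ := gen_choiceMixin term.

Definition pa_identity (t1 t2 : term) : Prop :=
  forall A : linearAlgebraType k, power_associative A ->
  forall v : V -> A, eval v t1 = eval v t2.

Definition pa_rel : rel term := fun t1 t2 => `[< pa_identity t1 t2 >].

Fact pa_rel_equiv : equiv_class_of pa_rel.
Proof.
split=> [t|t u|t u w].
- exact/asboolP.
- by apply/asboolP/asboolP => h A pA v; rewrite h.
- by move=> /asboolP tu /asboolP uw; apply/asboolP => A pA v; rewrite tu // uw.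
Qed.

Canonical pa_equiv : equiv_rel term := EquivRelPack pa_rel_equiv.

(* F(V) is the term algebra modulo the identities of the variety; its universal
   property is [free_pa_universal] below. *)
Definition free_pa := {eq_quot pa_equiv}.
HB.instance Definition _ := Choice.on free_pa.

Implicit Types x y z : free_pa.

Definition free_class (t : term) : free_pa := \pi_free_pa t.

Definition free_gen (i : V) : free_pa := free_class (TVar i).

Lemma free_classP t u : free_class t = free_class u <-> pa_identity t u.
Proof.
split=> [/eqmodP/asboolP //|h].
by apply/eqmodP/asboolP.
Qed.

Definition free_eval (A : linearAlgebraType k) (v : V -> A) x : A :=
  eval v (repr x).

Lemma free_evalE (A : linearAlgebraType k) (v : V -> A) t :
  power_associative A -> free_eval v (free_class t) = eval v t.
Proof.
move=> pA; rewrite /free_eval.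
have /free_classP -> // : free_class (repr (free_class t)) = free_class t.
by rewrite /free_class reprK.
Qed.

Lemma free_eval_inj x y :
  (forall A : linearAlgebraType k, power_associative A ->
   forall v : V -> A, free_eval v x = free_eval v y) -> x = y.
Proof.
move=> h; rewrite -[x]reprK -[y]reprK; apply/free_classP => A pA v.
exact: h.
Qed.

Definition free_zero := free_class TZero.
Definition free_add x y := free_class (TAdd (repr x) (repr y)).
Definition free_scale (l : k) x := free_class (TScale l (repr x)).
Definition free_opp x := free_scale (-1) x.
Definition free_mul x y := free_class (TMul (repr x) (repr y)).

Lemma free_eval_op (A : linearAlgebraType k) (pA : power_associative A)
    (v : V -> A) :
  (free_eval v free_zero = 0) *
  (forall x y, free_eval v (free_add x y) = free_eval v x + free_eval v y) *
  (forall l x, free_eval v (free_scale l x) = l *: free_eval v x) *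
  (forall x, free_eval v (free_opp x) = - free_eval v x) *
  (forall x y, free_eval v (free_mul x y) = (free_eval v x * free_eval v y)%g).
Proof.
by do !split=> *; rewrite [LHS](free_evalE _ _ pA) //= scaleN1r.
Qed.

Fact free_addA : associative free_add.
Proof. by move=> x y z; apply: free_eval_inj => A pA v; rewrite !(free_eval_op pA) addrA. Qed.
Fact free_addC : commutative free_add.
Proof. by move=> x y; apply: free_eval_inj => A pA v; rewrite !(free_eval_op pA) addrC. Qed.
Fact free_add0 : left_id free_zero free_add.
Proof. by move=> x; apply: free_eval_inj => A pA v; rewrite !(free_eval_op pA) add0r. Qed.
Fact free_addN : left_inverse free_zero free_opp free_add.
Proof. by move=> x; apply: free_eval_inj => A pA v; rewrite !(free_eval_op pA) addNr. Qed.

HB.instance Definition _ := GRing.isZmodule.Build free_pa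
  free_addA free_addC free_add0 free_addN.

Fact free_scaleA a b x : free_scale a (free_scale b x) = free_scale (a * b) x.
Proof. by apply: free_eval_inj => A pA v; rewrite !(free_eval_op pA) scalerA. Qed.
Fact free_scale1 : left_id 1 free_scale.
Proof. by move=> x; apply: free_eval_inj => A pA v; rewrite !(free_eval_op pA) scale1r. Qed.
Fact free_scaleDr : right_distributive free_scale +%R.
Proof.
move=> a x y; change (free_scale a (free_add x y) =
  free_add (free_scale a x) (free_scale a y)).
by apply: free_eval_inj => A pA v; rewrite !(free_eval_op pA) scalerDr.
Qed.
Fact free_scaleDl x : {morph free_scale^~ x : a b / a + b}.
Proof.
move=> a b; change (free_scale (a + b) x =
  free_add (free_scale a x) (free_scale b x)).
by apply: free_eval_inj => A pA v; rewrite !(free_eval_op pA) scalerDl.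
Qed.

HB.instance Definition _ := GRing.Zmodule_isLmodule.Build k free_pa
  free_scaleA free_scale1 free_scaleDr free_scaleDl.

HB.instance Definition _ := hasMul.Build free_pa free_mul.

Fact free_mulDl x y z : ((x + y) * z)%g = (x * z)%g + (y * z)%g.
Proof.
change (free_mul (free_add x y) z = free_add (free_mul x z) (free_mul y z)).
by apply: free_eval_inj => A pA v; rewrite !(free_eval_op pA) amulDl.
Qed.
Fact free_mulDr x y z : (x * (y + z))%g = (x * y)%g + (x * z)%g.
Proof.
change (free_mul x (free_add y z) = free_add (free_mul x y) (free_mul x z)).
by apply: free_eval_inj => A pA v; rewrite !(free_eval_op pA) amulDr.
Qed.
Fact free_mulZl (l : k) x y : ((l *: x) * y)%g = l *: (x * y)%g.
Proof.
change (free_mul (free_scale l x) y = free_scale l (free_mul x y)).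
by apply: free_eval_inj => A pA v; rewrite !(free_eval_op pA) amulZl.
Qed.
Fact free_mulZr (l : k) x y : (x * (l *: y))%g = l *: (x * y)%g.
Proof.
change (free_mul x (free_scale l y) = free_scale l (free_mul x y)).
by apply: free_eval_inj => A pA v; rewrite !(free_eval_op pA) amulZr.
Qed.

HB.instance Definition _ := Lmodule_Magma_isBilinear.Build k free_pa
  free_mulDl free_mulDr free_mulZl free_mulZr.

Definition free_eval_hom (A : linearAlgebraType k) (pA : power_associative A)
  (v : V -> A) : algebra_hom free_pa A.
Proof.
apply: (@AlgebraHom k free_pa A (free_eval v)) => [l x y|x y].
- by rewrite [LHS](free_eval_op pA v).1.1.1.2 (free_eval_op pA v).1.1.2.
- exact: (free_eval_op pA v).2.
Defined.

Lemma free_pa_power_associative : power_associative free_pa.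
Proof.
move=> b1 b2 eb x; apply: free_eval_inj => A pA v.
have evalb b : free_eval v (bracket_pow b x) = bracket_pow b (free_eval v x).
  elim: b => //= c1 IH1 c2 IH2.
  by rewrite [LHS](free_eval_op pA v).2 IH1 IH2.
by rewrite !evalb; apply: pA.
Qed.

Lemma free_class_eval t : free_class t = eval free_gen t.
Proof.
elim: t => //= [t1 IH1 t2 IH2|t1 IH1 t2 IH2|l t IH].
- rewrite -IH1 -IH2; apply: free_eval_inj => A pA v.
  by rewrite [RHS](free_eval_op pA v).1.1.1.2 !free_evalE.
- rewrite -IH1 -IH2; apply: free_eval_inj => A pA v.
  by rewrite [RHS](free_eval_op pA v).2 !free_evalE.
- rewrite -IH; apply: free_eval_inj => A pA v.
  by rewrite [RHS](free_eval_op pA v).1.1.2 !free_evalE.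
Qed.

Lemma free_pa_universal (A : linearAlgebraType k) (v : V -> A) :
  power_associative A ->
  exists! f : algebra_hom free_pa A, forall i, f (free_gen i) = v i.
Proof.
move=> pA; exists (free_eval_hom pA v); split=> [i|f fv].
  exact: (free_evalE v (TVar i) pA).
apply: algebra_hom_inj => x /=; rewrite /free_eval.
rewrite -[in RHS](reprK x) -/(free_class _) free_class_eval.
elim: (repr x) => [i||t1 IH1 t2 IH2|t1 IH1 t2 IH2|l t IH] /=.
- by rewrite fv.
- by rewrite algebra_hom0.
- by rewrite algebra_homD IH1 IH2.
- by rewrite algebra_homM IH1 IH2.
- by rewrite algebra_homZ IH.
Qed.

End FreePowerAssociative.

(* The variables x_1, x_2, ... are the natural numbers; the object X stands
   for F(X), objects with distinct generating sets being distinct. *)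
Definition free_pa_category (k : fieldType) : category.
Proof.
apply: (@Category {fset nat}
  (fun X Y => algebra_hom (free_pa k X) (free_pa k Y))
  (fun X => algebra_hom_id (free_pa k X))
  (fun X Y Z g f => algebra_hom_comp g f)).
- by move=> X Y f; apply: algebra_hom_inj.
- by move=> X Y f; apply: algebra_hom_inj.
- by move=> X Y Z T h g f; apply: algebra_hom_inj.
Defined.

(* Main.v *)
Require Import Defs.
From mathcomp Require Import all_boot all_order all_algebra finmap.
From HB Require Import structures.
From mathcomp Require Import boolp ring zify.

(* Twisting the multiplication of F(X) into
     x o y = (1 + c)/2 xy + (1 - c)/2 yx
   and its scalar action by a field automorphism phi gives again a power
   associative algebra, so there is a bijection S of F(X) onto the twisted algebra
   fixing the generators; psi |-> S psi S^-1 is an automorphism of the category,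
   and composing two of these bijections multiplies the pairs (c, phi) in the
   semidirect product.

   Conversely, let U be an automorphism.  Among the objects that are not retracts
   of every object, F(x) is characterised as a retract of all the others, so U
   preserves it.  As F(X) is Hom(F(x), F(X)), U is then given, up to isomorphisms
   U(F(X)) = F(X), by conjugation with bijections s of the sets F(X) that fix the
   generators.  A natural bijection commuting with all homomorphisms is
   multiplication by a scalar, because it is substitution of an element w of F(x),
   a polynomial with a compositional inverse.  Applied to s(l s^-1(-)) this shows
   s(l u) = phi(l) s(u) with phi onto.  The elements s(x + y) and s(xy) of F(x, y)
   are therefore homogeneous of degree 1 and 2, which forces s(u + v) = s(u) + s(v)
   and s(uv) = b s(u)s(v) + c s(v)s(u).  Multiplying s by the scalar b + c, which
   commutes with all homomorphisms, normalises b + c to 1. *)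

Set Implicit Arguments.
Unset Strict Implicit.
Unset Printing Implicit Defensive.

Import GRing.Theory.
Local Open Scope ring_scope.

(** * Linear algebras and the grading of free algebras *)

Section LinearAlgebraTheory.
Variables (k : fieldType) (A : linearAlgebraType k).
Implicit Types x y : A.

Lemma amul0l x : (0 * x)%g = 0 :> A.
Proof. by have := amulZl 0 0 x; rewrite !scale0r. Qed.

Lemma amul0r x : (x * 0)%g = 0 :> A.
Proof. by have := amulZr 0 x 0; rewrite !scale0r. Qed.

Lemma amul_suml I (r : seq I) (F : I -> A) x :
  ((\sum_(i <- r) F i) * x)%g = \sum_(i <- r) (F i * x)%g.
Proof.
by elim: r => [|i r IH]; rewrite ?big_nil ?amul0l // !big_cons amulDl IH.
Qed.

Lemma amul_sumr I (r : seq I) (F : I -> A) x :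
  (x * (\sum_(i <- r) F i))%g = \sum_(i <- r) (x * F i)%g.
Proof.
by elim: r => [|i r IH]; rewrite ?big_nil ?amul0r // !big_cons amulDr IH.
Qed.

Lemma algebra_hom_sum (B : linearAlgebraType k) (f : algebra_hom A B)
    I (r : seq I) (F : I -> A) :
  f (\sum_(i <- r) F i) = \sum_(i <- r) f (F i).
Proof.
by elim: r => [|i r IH]; rewrite ?big_nil ?algebra_hom0 // !big_cons algebra_homD IH.
Qed.

Definition zero_hom (B : linearAlgebraType k) : algebra_hom B A.
Proof.
by apply: (@AlgebraHom k B A (fun=> 0)) => [l|] x y; rewrite ?scaler0 ?addr0 ?amul0l.
Defined.

Lemma algebra_hom_bij_inv (B : linearAlgebraType k) (f : algebra_hom A B) g :
  cancel f g -> cancel g f -> exists h : algebra_hom B A, h =1 g.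
Proof.
move=> fg gf.
have gl : linear g.
  by move=> l x y; apply: (can_inj fg); rewrite algebra_hom_linear !gf.
have gM : {morph g : x y / (x * y)%g}.
  by move=> x y; apply: (can_inj fg); rewrite algebra_homM !gf.
by exists (AlgebraHom gl gM).
Qed.

End LinearAlgebraTheory.

Section FreeTheory.
Variables (k : fieldType) (V : Type).
Local Notation F := (free_pa k V).
Local Notation gen := (@free_gen k V).

Lemma free_pa_ind (P : F -> Prop) :
  (forall i, P (gen i)) -> P 0 -> (forall x y, P x -> P y -> P (x + y)) ->
  (forall x y, P x -> P y -> P (x * y)%g) -> (forall l x, P x -> P (l *: x)) ->
  forall x, P x.
Proof.
move=> Pg P0 PD PM PZ x; rewrite -[x]reprK -/(free_class _) free_class_eval.
by elim: (repr x) => //= *; auto.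
Qed.

Lemma free_hom_ext (A : linearAlgebraType k) (f g : algebra_hom F A) :
  (forall i, f (gen i) = g (gen i)) -> f =1 g.
Proof.
move=> fg; apply: free_pa_ind => // [|x y fx fy|x y fx fy|l x fx].
- by rewrite !algebra_hom0.
- by rewrite !algebra_homD fx fy.
- by rewrite !algebra_homM fx fy.
- by rewrite !algebra_homZ fx.
Qed.

Lemma free_eval_gen (A : linearAlgebraType k) (pA : power_associative A) v i :
  free_eval_hom pA v (gen i) = v i.
Proof. exact: (free_evalE v (TVar i) pA). Qed.

Definition subst_hom (W : Type) (v : V -> free_pa k W) :
  algebra_hom F (free_pa k W) :=
  free_eval_hom (@free_pa_power_associative k W) v.

Lemma subst_hom_gen (W : Type) (v : V -> free_pa k W) i :
  subst_hom v (gen i) = v i.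
Proof. exact: free_eval_gen. Qed.

(** Degree is a relation because 0 lies in every degree; distinct degrees are told apart later by
    the eigenvalues of [scale_gens]. *)
Inductive homog : nat -> F -> Prop :=
  | homog_gen i : homog 1 (gen i)
  | homog0 n : homog n 0
  | homogD n x y : homog n x -> homog n y -> homog n (x + y)
  | homogZ n l x : homog n x -> homog n (l *: x)
  | homogM m n x y : homog m x -> homog n y -> homog (m + n) (x * y)%g.

Definition homog_sum (x : F) : Prop :=
  exists (r : nat -> F) (n : nat),
    (forall i, homog i (r i)) /\ x = \sum_(i < n) r i.

Lemma homog_sumD x y : homog_sum x -> homog_sum y -> homog_sum (x + y).
Proof.
move=> [r [n [hr ->]]] [r' [n' [hr' ->]]].
(* Components beyond the bound of a decomposition need not vanish, so each family is cut off at its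
   own bound before adding. *)
exists (fun i => (if (i < n)%N then r i else 0) +
                 (if (i < n')%N then r' i else 0)), (n + n')%N.
split=> [i|]; first by apply: homogD; case: ifP => _ //; apply: homog0.
rewrite big_split; congr (_ + _); rewrite -[RHS](big_mkcond (fun i : 'I__ => (i < _)%N)).
  by rewrite -(big_ord_widen _ r) // leq_addr.
by rewrite -(big_ord_widen _ r') // leq_addl.
Qed.

Lemma homog_homog_sum n x : homog n x -> homog_sum x.
Proof.
move=> hx; exists (fun i => if i == n then x else 0), n.+1; split=> [i|].
  by case: eqP => [->|_] //; apply: homog0.
rewrite big_ord_recr /= eqxx big1 ?add0r // => i _.
by rewrite ltn_eqF.
Qed.

Lemma homog_sum_sum I (s : seq I) (G : I -> F) :
  (forall i, homog_sum (G i)) -> homog_sum (\sum_(i <- s) G i).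
Proof.
move=> hG; elim: s => [|i s IH]; last by rewrite big_cons; apply: homog_sumD.
by rewrite big_nil; apply: (@homog_homog_sum 0); apply: homog0.
Qed.

Lemma homog_sumP x : homog_sum x.
Proof.
elim/free_pa_ind: x => [i||x y|x y [r [n [hr ->]]] [r' [n' [hr' ->]]]|l x [r [n [hr ->]]]].
- exact/homog_homog_sum/homog_gen.
- exact/(@homog_homog_sum 0)/homog0.
- exact: homog_sumD.
- rewrite amul_suml; apply: homog_sum_sum => i.
  rewrite amul_sumr; apply: homog_sum_sum => j.
  exact/homog_homog_sum/homogM.
- rewrite scaler_sumr; apply: homog_sum_sum => i.
  exact/homog_homog_sum/homogZ.
Qed.

Definition scale_gens (l : k) := subst_hom (fun i => l *: gen i).

Lemma scale_gens_homog l n x : homog n x -> scale_gens l x = l ^+ n *: x.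
Proof.
elim=> [i|m|m y z _ IHy _ IHz|m a y _ IH|m m' y z _ IHy _ IHz].
- by rewrite subst_hom_gen.
- by rewrite algebra_hom0 scaler0.
- by rewrite algebra_homD IHy IHz scalerDr.
- by rewrite algebra_homZ IH !scalerA mulrC.
- by rewrite algebra_homM IHy IHz amulZl amulZr scalerA exprD.
Qed.

(** Generators have degree 1, degrees add and no unit is available, so a product of degree 0 has a
    factor of degree 0. The degree is a variable tied by an equation so that induction on [homog]
    applies. *)
Lemma homog0_eq0 n x : homog n x -> n = 0 -> x = 0.
Proof.
elim=> [i|m|m y z _ IHy _ IHz|m a y _ IH|[|m] m' y z _ IHy _ IHz] //.
- by move=> m0; rewrite IHy // IHz // addr0.
- by move=> m0; rewrite IH // scaler0.
- by rewrite IHy // amul0l.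
Qed.

Section TwoGenerators.
Variables i j : V.
Hypothesis ijP : forall v, v = i \/ v = j.

Lemma homog1_lin n x : homog n x -> n = 1%N ->
  exists a b, x = a *: gen i + b *: gen j.
Proof.
have zero : exists a b, (0 : F) = a *: gen i + b *: gen j.
  by exists 0, 0; rewrite !scale0r addr0.
elim=> [v|m|m y z _ IHy _ IHz|m a y _ IH|[|[|m]] [|m'] y z hy IHy hz IHz] //.
- by case: (ijP v) => -> _; [exists 1, 0|exists 0, 1]; rewrite scale0r scale1r ?addr0 ?add0r.
- move=> m1; have [a [b ->]] := IHy m1; have [a' [b' ->]] := IHz m1.
  by exists (a + a'), (b + b'); rewrite !scalerDl addrACA.
- move=> m1; have [b [c ->]] := IH m1.
  by exists (a * b), (a * c); rewrite scalerDr !scalerA.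
- by rewrite (homog0_eq0 hy) // amul0l.
- by rewrite (homog0_eq0 hz) // amul0r.
Qed.

(** In a product of total degree 2 either both factors are linear or one has degree 0 and
    vanishes. *)
Lemma homog2_quad n x : homog n x -> n = 2%N ->
  exists a b c d, x = a *: (gen i * gen i)%g + b *: (gen i * gen j)%g +
    (c *: (gen j * gen i)%g + d *: (gen j * gen j)%g).
Proof.
set Q := fun x : F => exists a b c d, x =
  a *: (gen i * gen i)%g + b *: (gen i * gen j)%g +
    (c *: (gen j * gen i)%g + d *: (gen j * gen j)%g).
have zero : Q 0 by exists 0, 0, 0, 0; rewrite !scale0r !addr0.
rewrite -/(Q x); elim=> [v|m|m y z _ IHy _ IHz|m l y _ IH|[|[|[|m]]] [|[|m']] y z hy IHy hz IHz] //.
- move=> m1; have [a [b [c [d ->]]]] := IHy m1.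
  have [a' [b' [c' [d' ->]]]] := IHz m1.
  by exists (a + a'), (b + b'), (c + c'), (d + d');
    rewrite !scalerDl addrACA; congr (_ + _); rewrite addrACA.
- move=> m1; have [a [b [c [d ->]]]] := IH m1.
  by exists (l * a), (l * b), (l * c), (l * d); rewrite !scalerDr !scalerA.
- by rewrite (homog0_eq0 hy) // amul0l.
- move=> _; have [a [b ->]] := homog1_lin hy erefl.
  have [c [d ->]] := homog1_lin hz erefl.
  exists (a * c), (a * d), (b * c), (b * d).
  by rewrite !amulDl !amulDr !amulZl !amulZr !scalerA.
- by rewrite (homog0_eq0 hz) // amul0r.
Qed.

End TwoGenerators.

Section CharZero.
Hypothesis char_k0 : [pchar k] =i pred0.

(** Characteristic zero separates the degrees here: the eigenvalues 2 ^+ n of [scale_gens 2] are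
    distinct. *)
Lemma expr2n_inj m n : (2 ^+ m == 2 ^+ n :> k) = (m == n).
Proof.
apply/eqP/eqP => [|->//]; rewrite -!natrX => e.
have natr_inj a b : a%:R = b%:R :> k -> (a <= b)%N -> a = b.
  move=> eab leab; apply/eqP; rewrite eqn_leq leab -subn_eq0.
  by move/pcharf0P: char_k0 => <-; rewrite natrB // eab subrr eqxx.
have eN : (2 ^ m = 2 ^ n)%N.
  by case: (leqP (2 ^ m) (2 ^ n)) => [/(natr_inj _ _ e)//|/ltnW /(natr_inj _ _ (esym e))].
by apply/eqP; rewrite -(eqn_exp2l (m := 2)) // eN.
Qed.

(** Eigenvectors for distinct eigenvalues are linearly independent. *)
Lemma eigen_sum_eq0 (h : algebra_hom F F) n (r : nat -> F) :
  (forall i, h (r i) = 2 ^+ i *: r i) -> \sum_(i < n) r i = 0 ->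
  forall i, (i < n)%N -> r i = 0.
Proof.
elim: n r => // n IH r hr s0.
have lt_n i : (i < n)%N -> r i = 0.
  (* Applying [h] to the relation and subtracting 2 ^+ n times it kills the top term; what remains
     is a shorter relation between the eigenvectors [r']. *)
  move=> ltin; pose r' i := (2 ^+ i - 2 ^+ n) *: r i.
  have : r' i = 0.
    apply: (IH r') => // [m|]; first by rewrite algebra_homZ hr !scalerA mulrC.
    have := congr1 h s0; rewrite algebra_hom_sum algebra_hom0 => s1.
    have := congr1 (fun x => 2 ^+ n *: x) s0; rewrite scaler0 scaler_sumr => s2.
    have : \sum_(i < n.+1) r' i = 0.
      transitivity (\sum_(i < n.+1) h (r i) - \sum_(i < n.+1) 2 ^+ n *: r i).
        by rewrite -sumrB; apply: eq_bigr => m _; rewrite hr -scalerBl.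
      by rewrite s1 s2 subrr.
    by rewrite big_ord_recr /= /r' subrr scale0r addr0.
  move/eqP; rewrite scaler_eq0 subr_eq0 expr2n_inj => /orP[/eqP ein|/eqP//].
  by rewrite ein ltnn in ltin.
move=> i; rewrite ltnS leq_eqVlt => /orP[/eqP->|]; last exact: lt_n.
move: s0; rewrite big_ord_recr /= big1 ?add0r // => j _.
exact: lt_n.
Qed.

(** Converse of [scale_gens_homog] for the scalar 2: subtracting 2 ^+ n x from the image of x
    multiplies the component of degree i by 2 ^+ i - 2 ^+ n, so all components with i != n
    vanish. *)
Lemma homog_of_scale_gens n x : scale_gens 2 x = 2 ^+ n *: x -> homog n x.
Proof.
have [r [m [hr ->]]] := homog_sumP x => e.
have r0 i : (i < m)%N -> i != n -> r i = 0.
  move=> lim nin; pose r' i := (2 ^+ i - 2 ^+ n) *: r i.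
  have : r' i = 0.
    apply: (@eigen_sum_eq0 (scale_gens 2) m) => // [j|].
      by rewrite algebra_homZ (scale_gens_homog _ (hr j)) !scalerA mulrC.
    transitivity (scale_gens 2 (\sum_(i < m) r i) - 2 ^+ n *: \sum_(i < m) r i).
      rewrite algebra_hom_sum scaler_sumr -sumrB; apply: eq_bigr => j _.
      by rewrite (scale_gens_homog _ (hr j)) -scalerBl.
    by rewrite e subrr.
  move/eqP; rewrite scaler_eq0 subr_eq0 expr2n_inj => /orP[/eqP ein|/eqP//].
  by rewrite ein eqxx in nin.
elim/big_ind: _ => [||i _]; [exact: homog0|exact: homogD|].
by case: (eqVneq (i : nat) n) => [<-//|/r0 -> //]; apply: homog0.
Qed.

End CharZero.
End FreeTheory.

(** * The free algebra of rank one and a nilpotent test algebra *)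

Section PolyAlgebra.
Variable k : fieldType.

(** An alias of k[X] on which the ring product becomes the product of a linear algebra. F(x) embeds
    into it, as polynomials without constant term. *)
Definition poly_algebra : Type := {poly k}.
HB.instance Definition _ := GRing.Lmodule.on poly_algebra.
HB.instance Definition _ :=
  hasMul.Build poly_algebra (fun p q => (p : {poly k}) * (q : {poly k})).

Fact poly_algebra_mulDl (x y z : poly_algebra) :
  ((x + y) * z)%g = (x * z)%g + (y * z)%g.
Proof. exact: mulrDl. Qed.
Fact poly_algebra_mulDr (x y z : poly_algebra) :
  (x * (y + z))%g = (x * y)%g + (x * z)%g.
Proof. exact: mulrDr. Qed.
Fact poly_algebra_mulZl (l : k) (x y : poly_algebra) :
  ((l *: x) * y)%g = l *: (x * y)%g.
Proof. by apply/esym; apply: (@scalerAl k {poly k}). Qed.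
Fact poly_algebra_mulZr (l : k) (x y : poly_algebra) :
  (x * (l *: y))%g = l *: (x * y)%g.
Proof. by apply/esym; apply: (@scalerAr k {poly k}). Qed.

HB.instance Definition _ := Lmodule_Magma_isBilinear.Build k poly_algebra
  poly_algebra_mulDl poly_algebra_mulDr poly_algebra_mulZl poly_algebra_mulZr.

Lemma poly_algebra_power_associative : power_associative poly_algebra.
Proof.
suff powE b (p : {poly k}) : bracket_pow b (p : poly_algebra) = p ^+ bracket_size b.
  by move=> b1 b2 eb p; rewrite !powE eb.
by elim: b => [|b1 IH1 b2 IH2]; rewrite ?expr1 //= IH1 IH2 exprD.
Qed.

Definition comp_poly_hom (q : {poly k}) : algebra_hom poly_algebra poly_algebra.
Proof.
apply: (@AlgebraHom k poly_algebra poly_algebra (fun p => (p : {poly k}) \Po q)).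
- by move=> l x y; apply: (linearP (comp_poly q)).
- by move=> x y; apply: comp_polyM.
Defined.

End PolyAlgebra.

Section OneGenerator.
Variables (k : fieldType) (V : Type) (i : V).
Hypothesis iP : forall v, v = i.
Local Notation F := (free_pa k V).
Local Notation gen := (@free_gen k V).

Definition free_poly : algebra_hom F (poly_algebra k) :=
  free_eval_hom (@poly_algebra_power_associative k) (fun=> 'X).

Lemma free_poly_gen v : free_poly (gen v) = 'X.
Proof. exact: free_eval_gen. Qed.

Fixpoint right_comb n := if n is n'.+1 then BNode BLeaf (right_comb n') else BLeaf.

Lemma right_comb_size n : bracket_size (right_comb n) = n.+1.
Proof. by elim: n => //= n ->. Qed.

(** Power associativity rebrackets a product of two powers of the generator into a right comb, so
    each degree is spanned by one power. In degree 0, where the predecessor is truncated, c is 0. *)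
Lemma homog_one_gen n x : homog n x -> exists c : k,
  x = c *: bracket_pow (right_comb n.-1) (gen i) /\ free_poly x = c *: 'X^n.
Proof.
elim=> [v|m|m y z _ [c [-> ec]] _ [d [-> ed]]|m a y _ [c [-> ec]]|m m' y z hy [c [ey ec]] hz [d [ez ed]]].
- by exists 1; rewrite !scale1r (iP v) free_poly_gen expr1.
- by exists 0; rewrite !scale0r algebra_hom0.
- by exists (c + d); rewrite !scalerDl algebra_homD ec ed.
- by exists (a * c); rewrite -!scalerA algebra_homZ ec.
have zero : (y * z)%g = 0 -> exists c0 : k, (y * z)%g =
    c0 *: bracket_pow (right_comb (m + m').-1) (gen i) /\
    free_poly (y * z)%g = c0 *: 'X^(m + m').
  by move=> ->; exists 0; rewrite !scale0r algebra_hom0.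
case: m m' hy hz ey ez ec ed zero => [|m] [|m'] hy hz ey ez ec ed zero.
- by apply: zero; rewrite (homog0_eq0 hy) // amul0l.
- by apply: zero; rewrite (homog0_eq0 hy) // amul0l.
- by apply: zero; rewrite (homog0_eq0 hz) // amul0r.
exists (c * d); split; last first.
  rewrite algebra_homM ec ed amulZl amulZr scalerA.
  by congr (_ *: _); rewrite exprD.
rewrite ey ez amulZl amulZr scalerA; congr (_ *: _).
apply: (@free_pa_power_associative k V (BNode (right_comb m) (right_comb m'))
  (right_comb (m.+1 + m'.+1).-1)).
by rewrite right_comb_size /= !right_comb_size.
Qed.

Lemma homog_coef_neq n m x : homog n x -> m != n -> (free_poly x : {poly k})`_m = 0.
Proof.
move=> /homog_one_gen[c [_ ec]] nm.
have -> : free_poly x = c *: 'X^n :> {poly k} by [].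
by rewrite coefZ coefXn (negPf nm) mulr0.
Qed.

Lemma homog_coef_eq0 n x : homog n x -> (free_poly x : {poly k})`_n = 0 -> x = 0.
Proof.
move=> /homog_one_gen[c [ex ec]].
have -> : free_poly x = c *: 'X^n :> {poly k} by [].
by rewrite coefZ coefXn eqxx mulr1 ex => ->; rewrite scale0r.
Qed.

(** The coefficient of X^j sees only the component of degree j, and determines it. *)
Lemma free_poly_inj : injective free_poly.
Proof.
suff inj0 x : free_poly x = 0 -> x = 0.
  move=> x y e; apply/eqP; rewrite -subr_eq0; apply/eqP/inj0.
  by rewrite algebra_homD -scaleN1r algebra_homZ e scaleN1r subrr.
have [r [n [hr ->]]] := homog_sumP x.
rewrite algebra_hom_sum => s0; apply: big1 => j _.
apply: (homog_coef_eq0 (hr j)).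
have := congr1 (fun p : {poly k} => p`_j) s0.
rewrite coef0 coef_sum (bigD1 j) //= big1 ?addr0 // => m mj.
by rewrite (homog_coef_neq (hr m)) // eq_sym.
Qed.

Lemma free_one_gen_mulC (x y : F) : (x * y)%g = (y * x)%g.
Proof.
by apply: free_poly_inj; rewrite !algebra_homM; apply: (@mulrC {poly k}).
Qed.

Lemma free_poly_subst (u w : F) :
  free_poly (subst_hom (fun=> u) w) = (free_poly w : {poly k}) \Po free_poly u.
Proof.
pose f := algebra_hom_comp free_poly (subst_hom (fun _ : V => u)).
suff e : f =1 algebra_hom_comp (comp_poly_hom (free_poly u)) free_poly by apply: e.
apply: free_hom_ext => v.
transitivity ((free_poly (gen v) : {poly k}) \Po free_poly u) => //.
rewrite free_poly_gen comp_polyX.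
exact: congr1 (subst_hom_gen _ v).
Qed.

Lemma free_poly_coef0 w : (free_poly w : {poly k})`_0 = 0.
Proof.
(* Substituting 0 for the generator is the zero homomorphism; on polynomials it is evaluation at
   0. *)
have w0 : subst_hom (fun=> 0) w = 0 :> F.
  by apply: (free_hom_ext (g := zero_hom F F)) => v; rewrite subst_hom_gen.
have := free_poly_subst 0 w.
by rewrite w0 algebra_hom0 comp_poly0r => /(congr1 (fun p : {poly k} => p`_0)); rewrite coefC coef0.
Qed.

(** Degrees multiply under composition, so deg w * deg u = 1; w has degree 1 and no constant
    term. *)
Lemma subst_inv_linear (u w : F) :
  subst_hom (fun=> u) w = gen i -> exists2 d, d != 0 & w = d *: gen i.
Proof.
move=> /(congr1 free_poly); rewrite free_poly_subst free_poly_gen => /(congr1 (fun p : {poly k} => (size p).-1)).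
rewrite size_comp_poly size_polyX => /eqP; rewrite muln_eq1 => /andP[sw _].
have {}sw : size (free_poly w : {poly k}) = 2 by case: size sw => // n /eqP /= ->.
exists (free_poly w : {poly k})`_1.
  by have := lead_coef_eq0 (free_poly w : {poly k}); rewrite lead_coefE sw -size_poly_eq0 sw => ->.
apply: free_poly_inj; rewrite algebra_homZ free_poly_gen.
apply/polyP => -[|[|n]]; rewrite coefZ coefX ?mulr0 ?mulr1 ?free_poly_coef0 //.
by rewrite nth_default // sw.
Qed.

Lemma free_gen_sqr_neq0 : (gen i * gen i)%g != 0.
Proof.
apply/eqP => /(congr1 free_poly); rewrite algebra_homM algebra_hom0 free_poly_gen.
by move/eqP; rewrite (@mulf_eq0 {poly k}) polyX_eq0.
Qed.

End OneGenerator.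

Section NullAlgebra.
Variable k : fieldType.

(* Basis e1, e2, p, q with e1 e2 = p, e2 e1 = q and all other products 0. *)
Definition null_algebra : Type := (k^o * k^o * (k^o * k^o))%type.
HB.instance Definition _ := GRing.Lmodule.on null_algebra.
HB.instance Definition _ := hasMul.Build null_algebra
  (fun x y => ((0, 0), (x.1.1 * y.1.2, x.1.2 * y.1.1)) : null_algebra).

Fact null_algebra_mulDl (x y z : null_algebra) :
  ((x + y) * z)%g = (x * z)%g + (y * z)%g.
Proof. by congr (_, _); congr (_, _); rewrite /= ?addr0 ?mulrDl. Qed.
Fact null_algebra_mulDr (x y z : null_algebra) :
  (x * (y + z))%g = (x * y)%g + (x * z)%g.
Proof. by congr (_, _); congr (_, _); rewrite /= ?addr0 ?mulrDr. Qed.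
Fact null_algebra_mulZl (l : k) (x y : null_algebra) :
  ((l *: x) * y)%g = l *: (x * y)%g.
Proof. by congr (_, _); congr (_, _); rewrite /= ?scaler0 -?scalerAl. Qed.
Fact null_algebra_mulZr (l : k) (x y : null_algebra) :
  (x * (l *: y))%g = l *: (x * y)%g.
Proof. by congr (_, _); congr (_, _); rewrite /= ?scaler0 -?scalerAr. Qed.

HB.instance Definition _ := Lmodule_Magma_isBilinear.Build k null_algebra
  null_algebra_mulDl null_algebra_mulDr null_algebra_mulZl null_algebra_mulZr.

Lemma null_algebra_mulA3 (x y z : null_algebra) :
  ((x * y) * z)%g = 0 /\ (x * (y * z))%g = 0.
Proof. by split; congr (_, _); congr (_, _); rewrite /= ?mul0r ?mulr0. Qed.

(** Every product of three or more factors is 0, and there is only one bracketing of one or of two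
    factors. *)
Lemma null_algebra_power_associative : power_associative null_algebra.
Proof.
have pow0 b x : (2 < bracket_size b)%N -> bracket_pow b x = 0 :> null_algebra.
  case: b => //= -[|b1 b2] [|b3 b4] //= _.
  - by case: (null_algebra_mulA3 x (bracket_pow b3 x) (bracket_pow b4 x)).
  - by case: (null_algebra_mulA3 (bracket_pow b1 x) (bracket_pow b2 x) x).
  - by case: (null_algebra_mulA3 (bracket_pow b1 x) (bracket_pow b2 x)
      (bracket_pow b3 x * bracket_pow b4 x)%g).
have size_gt0 b : (0 < bracket_size b)%N by elim: b => //= b1 h b2 _; rewrite addn_gt0 h.
move=> b1 b2 eb x; have [gt2|] := ltnP 2 (bracket_size b1).
  by rewrite !pow0 // -eb.
have small b : (bracket_size b <= 2)%N -> b = BLeaf \/ b = BNode BLeaf BLeaf.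
  case: b => [|c1 c2] /=; first by left.
  case: c1 c2 => [|d1 d2] [|d3 d4] /= le2; first by right.
  - by have := size_gt0 d3; have := size_gt0 d4; lia.
  - by have := size_gt0 d1; have := size_gt0 d2; lia.
  - by have := size_gt0 d1; have := size_gt0 d2; have := size_gt0 d3; lia.
move=> le1; have le2 : (bracket_size b2 <= 2)%N by rewrite -eb.
by case: (small _ le1) (small _ le2) eb => -> [->|->].
Qed.

(** Sending [i] to e1 and all other generators to e2 turns the two products into the independent
    elements p and q. *)
Lemma free_gens_mul_free (V : eqType) (i j : V) (a b : k) : i != j ->
  a *: (free_gen k i * free_gen k j)%g + b *: (free_gen k j * free_gen k i)%g = 0 ->
  a = 0 /\ b = 0.
Proof.
move=> ij; pose v x : null_algebra := if x == i then ((1, 0), (0, 0)) else ((0, 1), (0, 0)).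
pose f := free_eval_hom null_algebra_power_associative v.
move/(congr1 f); rewrite algebra_homD !algebra_homZ !algebra_homM algebra_hom0.
rewrite !free_eval_gen /v eqxx eq_sym (negPf ij) => -[].
by rewrite /= !mulr1 !mulr0 !scaler0 !addr0 !add0r ![_ *: 1]mulr1.
Qed.

End NullAlgebra.

(** * Twisted maps *)

Definition twisted_mul (k : fieldType) (A : linearAlgebraType k) (c : k) (x y : A) : A :=
  ((1 + c) / 2) *: (x * y)%g + ((1 - c) / 2) *: (y * x)%g.

(* Equivalently, [f] maps [x y + y x] to [f x f y + f y f x] and [x y - y x] to
   [c (f x f y - f y f x)]. *)
Definition twisted (k : fieldType) (A B : linearAlgebraType k) (c : k)
    (phi : {rmorphism k -> k}) (f : A -> B) : Prop :=
  [/\ {morph f : x y / x + y}, forall l x, f (l *: x) = phi l *: f x &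
      forall x y, f (x * y)%g = twisted_mul c (f x) (f y)].

Section TwistedMul.
Variables (k : fieldType) (A : linearAlgebraType k) (c : k).
Implicit Types x y z : A.

Lemma twisted_mul_Dl x y z :
  twisted_mul c (x + y) z = twisted_mul c x z + twisted_mul c y z.
Proof. by rewrite /twisted_mul amulDl amulDr !scalerDr addrACA. Qed.

Lemma twisted_mul_Dr x y z :
  twisted_mul c x (y + z) = twisted_mul c x y + twisted_mul c x z.
Proof. by rewrite /twisted_mul amulDl amulDr !scalerDr addrACA. Qed.

Lemma twisted_mul_Zl l x y : twisted_mul c (l *: x) y = l *: twisted_mul c x y.
Proof.
by rewrite /twisted_mul amulZl amulZr scalerDr !scalerA ![_ * l]mulrC.
Qed.

Lemma twisted_mul_Zr l x y : twisted_mul c x (l *: y) = l *: twisted_mul c x y.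
Proof.
by rewrite /twisted_mul amulZl amulZr scalerDr !scalerA ![_ * l]mulrC.
Qed.

End TwistedMul.

Section TwistedAlgebra.
Variables (k : fieldType) (c : k) (phi : {rmorphism k -> k}).
Variable A : linearAlgebraType k.

(** The dummy arguments record [c] and [phi] in the type, so that each pair gets its own algebra
    structure on the set A. A twisted map into A is a homomorphism into this algebra. *)
Definition twisted_algebra (_ : k) (_ : {rmorphism k -> k}) : Type := A.
Local Notation T := (twisted_algebra c phi).

HB.instance Definition _ := GRing.Zmodule.on T.

Let scale (l : k) (x : T) : T := phi l *: (x : A).

Fact twisted_scaleA a b x : scale a (scale b x) = scale (a * b) x.
Proof. by rewrite /scale scalerA -rmorphM. Qed.
Fact twisted_scale1 : left_id 1 scale.
Proof. by move=> x; rewrite /scale rmorph1 scale1r. Qed.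
Fact twisted_scaleDr : right_distributive scale +%R.
Proof. by move=> a x y; apply: scalerDr. Qed.
Fact twisted_scaleDl x : {morph scale^~ x : a b / a + b}.
Proof. by move=> a b; rewrite /scale rmorphD scalerDl. Qed.

HB.instance Definition _ := GRing.Zmodule_isLmodule.Build k T
  twisted_scaleA twisted_scale1 twisted_scaleDr twisted_scaleDl.

HB.instance Definition _ :=
  hasMul.Build T (fun x y => twisted_mul c (x : A) (y : A)).

HB.instance Definition _ := Lmodule_Magma_isBilinear.Build k T
  (@twisted_mul_Dl k A c) (@twisted_mul_Dr k A c)
  (fun l x y => twisted_mul_Zl c (phi l) (x : A) (y : A))
  (fun l x y => twisted_mul_Zr c (phi l) (x : A) (y : A)).

(** Powers of one element commute, and the weights (1 + c)/2 and (1 - c)/2 add up to 1, so both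
    products give the same powers. *)
Lemma twisted_power_associative :
  2 != 0 :> k -> power_associative A -> power_associative T.
Proof.
move=> k2 pA.
suff powE b (x : A) : bracket_pow b (x : T) = bracket_pow b x.
  by move=> b1 b2 eb x; rewrite !powE; apply: pA.
elim: b => //= b1 -> b2 ->.
change (twisted_mul c (bracket_pow b1 x) (bracket_pow b2 x) =
  (bracket_pow b1 x * bracket_pow b2 x)%g).
have /= e := pA (BNode b2 b1) (BNode b1 b2) (addnC _ _) x; rewrite /twisted_mul e.
by rewrite -scalerDl [X in X *: _](_ : _ = 1) ?scale1r //; field.
Qed.

End TwistedAlgebra.

Section Twisted.
Variable k : fieldType.
Hypothesis k2 : 2 != 0 :> k.
Implicit Types A B C : linearAlgebraType k.

Lemma twisted1P A B (f : A -> B) :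
  twisted 1 idfun f <-> exists g : algebra_hom A B, g =1 f.
Proof.
have mul1E (x y : B) : twisted_mul 1 x y = (x * y)%g.
  rewrite /twisted_mul subrr mul0r scale0r addr0.
  by rewrite [X in X *: _](_ : _ = 1) ?scale1r //; field.
split=> [[fD fZ fM]|[g gf]].
  have fl : linear f by move=> l x y; rewrite fD fZ.
  have fM' : {morph f : x y / (x * y)%g} by move=> x y; rewrite fM mul1E.
  by exists (AlgebraHom fl fM').
split=> [x y|l x|x y]; rewrite -!gf ?mul1E.
- exact: algebra_homD.
- exact: algebra_homZ.
- exact: algebra_homM.
Qed.

(** Anticommutators keep weight 1, while the weights of commutators multiply; [c] passes through the
    semilinear map [g] and becomes [psi c]. This is the multiplication of the semidirect product. *)
Lemma twisted_comp A B C (f : A -> B) (g : B -> C) c d (phi psi chi : {rmorphism k -> k}) e :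
  twisted c phi f -> twisted d psi g -> chi =1 psi \o phi -> e = d * psi c ->
  twisted e chi (g \o f).
Proof.
move=> [fD fZ fM] [gD gZ gM] chiE ->; split=> [x y|l x|x y] /=.
- by rewrite fD gD.
- by rewrite fZ gZ chiE.
rewrite fM /twisted_mul gD !gZ !gM /twisted_mul !scalerDr !scalerA.
rewrite !rmorphM !fmorphV (rmorph_nat psi 2) !rmorphD rmorphN rmorph1.
rewrite [X in X + _]addrC addrACA -!scalerDl addrC.
by congr (_ *: _ + _ *: _); field.
Qed.

Lemma twisted_ext V A (f g : free_pa k V -> A) c (phi : {rmorphism k -> k}) :
  twisted c phi f -> twisted c phi g ->
  (forall i, f (free_gen k i) = g (free_gen k i)) -> f =1 g.
Proof.
move=> [fD fZ fM] [gD gZ gM] fg; apply: free_pa_ind => // [|x y fx fy|x y fx fy|l x fx].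
- by rewrite -(scale0r 0) fZ gZ !rmorph0 !scale0r.
- by rewrite fD gD fx fy.
- by rewrite fM gM fx fy.
- by rewrite fZ gZ fx.
Qed.

(** The homomorphism of F(V) into its twisted copy that fixes the generators, read as a map of F(V)
    into itself. *)
Definition twisted_eval V c (phi : {rmorphism k -> k}) :
  free_pa k V -> free_pa k V :=
  @free_eval k V (twisted_algebra (free_pa k V) c phi) (@free_gen k V).

Lemma twisted_eval_gen V c phi i :
  twisted_eval c phi (free_gen k i) = free_gen k i :> free_pa k V.
Proof.
exact: (free_eval_gen (twisted_power_associative k2
  (@free_pa_power_associative k V)) (@free_gen k V) i).
Qed.

Lemma twisted_evalP V c phi : twisted c phi (@twisted_eval V c phi).
Proof.
pose f := free_eval_hom (@twisted_power_associative k c phi _ k2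
  (@free_pa_power_associative k V)) (@free_gen k V).
split=> [x y|l x|x y].
- exact: (algebra_homD f).
- exact: (algebra_homZ f).
- exact: (algebra_homM f).
Qed.

End Twisted.

(** * The automorphisms defined by twisting *)

(** Both object maps are literally the identity, so morphism maps can be compared without transport
    between hom types. *)
Lemma eq_endofunctor_id (C : category)
    (m m' : forall A B : obj C, Defs.hom A B -> Defs.hom A B) e1 eM e1' eM' :
  (forall A B f, m A B f = m' A B f) ->
  @Endofunctor C id m e1 eM = @Endofunctor C id m' e1' eM'.
Proof.
move=> mm'; have em : m = m'.
  by apply/functional_extensionality_dep => A;
    apply/functional_extensionality_dep => B; apply/funext => f.
by subst m'; congr Endofunctor; apply: Prop_irrelevance.
Qed.

Section TwistAutomorphism.
Variable k : fieldType.
Hypothesis k2 : 2 != 0 :> k.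
Local Notation G := (semidirect (natural_action k)).
Local Notation cat := (free_pa_category k).
Implicit Types g h : G.

Definition twist_scalar g : k := unit_val (sd_normal g).
Definition twist_field g : {rmorphism k -> k} := field_aut_fun (sd_compl g).

Definition twist_map g V : free_pa k V -> free_pa k V :=
  twisted_eval (twist_scalar g) (twist_field g).

Lemma twist_mapP g V : twisted (twist_scalar g) (twist_field g) (@twist_map g V).
Proof. exact: twisted_evalP. Qed.

Lemma twist_map_gen g V i : twist_map g (free_gen k i) = free_gen k i :> free_pa k V.
Proof. exact: twisted_eval_gen. Qed.

Lemma twisted_comp_group g h e (A B C : linearAlgebraType k) (f : A -> B) (f' : B -> C) :
  e = (g * h)%g ->
  twisted (twist_scalar h) (twist_field h) f ->
  twisted (twist_scalar g) (twist_field g) f' ->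
  twisted (twist_scalar e) (twist_field e) (f' \o f).
Proof. by move=> -> tf tf'; apply: (twisted_comp k2 tf tf'). Qed.

Lemma twisted_group1P (A B : linearAlgebraType k) (f : A -> B) :
  twisted (twist_scalar 1%g) (twist_field 1%g) f <->
  exists g : algebra_hom A B, g =1 f.
Proof. exact: twisted1P. Qed.

Lemma twist_mapM g h V (x : free_pa k V) :
  twist_map (g * h)%g x = twist_map g (twist_map h x).
Proof.
apply: (twisted_ext (twist_mapP _ V)
  (twisted_comp_group erefl (twist_mapP h V) (twist_mapP g V))) => i.
by rewrite /= !twist_map_gen.
Qed.

Lemma twist_map1 V (x : free_pa k V) : twist_map 1%g x = x.
Proof.
apply: (twisted_ext (g := id) (twist_mapP _ V)) => [|i]; last exact: twist_map_gen.
by apply/twisted_group1P; exists (algebra_hom_id _).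
Qed.

Lemma twist_mapK g V : cancel (@twist_map g V) (@twist_map g^-1%g V).
Proof. by move=> x; rewrite -twist_mapM mulVg twist_map1. Qed.

Lemma twist_mapVK g V : cancel (@twist_map g^-1%g V) (@twist_map g V).
Proof. by move=> x; rewrite -twist_mapM mulgV twist_map1. Qed.

(** With S the map [twist_map g], this is S psi S^-1, given by its values on the generators, which
    S^-1 fixes. *)
Definition twist_hom g V W (psi : algebra_hom (free_pa k V) (free_pa k W)) :
  algebra_hom (free_pa k V) (free_pa k W) :=
  subst_hom (fun i => twist_map g (psi (free_gen k i))).

(** Both sides are twisted maps with the parameters of [g] and agree on the generators. *)
Lemma twist_homE g V W (psi : algebra_hom (free_pa k V) (free_pa k W)) x :
  twist_hom g psi (twist_map g x) = twist_map g (psi x).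
Proof.
have t1 (f : algebra_hom (free_pa k V) (free_pa k W)) :
    twisted (twist_scalar 1%g) (twist_field 1%g) f.
  by apply/twisted_group1P; exists f.
apply: (twisted_ext
  (twisted_comp_group (esym (mul1g g)) (twist_mapP g V) (t1 (twist_hom g psi)))
  (twisted_comp_group (esym (mulg1 g)) (t1 psi) (twist_mapP g W))) => i /=.
by rewrite twist_map_gen; apply: subst_hom_gen.
Qed.

Lemma twist_hom_id g V :
  twist_hom g (algebra_hom_id (free_pa k V)) = algebra_hom_id (free_pa k V).
Proof.
by apply: algebra_hom_inj => x; rewrite -[x](twist_mapVK g) twist_homE.
Qed.

Lemma twist_hom_comp g V W U (psi : algebra_hom (free_pa k W) (free_pa k U))
    (chi : algebra_hom (free_pa k V) (free_pa k W)) :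
  twist_hom g (algebra_hom_comp psi chi) =
  algebra_hom_comp (twist_hom g psi) (twist_hom g chi).
Proof.
apply: algebra_hom_inj => x; rewrite -[x](twist_mapVK g) twist_homE.
by rewrite [RHS](_ : _ = twist_hom g psi (twist_hom g chi
  (twist_map g (twist_map g^-1%g x)))) // !twist_homE.
Qed.

Lemma twist_homM g h V W (psi : algebra_hom (free_pa k V) (free_pa k W)) :
  twist_hom (g * h)%g psi = twist_hom g (twist_hom h psi).
Proof.
apply: algebra_hom_inj => x; rewrite -[x](twist_mapVK (g * h)%g) twist_homE.
by rewrite !twist_mapM !twist_homE.
Qed.

Lemma twist_hom1 V W (psi : algebra_hom (free_pa k V) (free_pa k W)) :
  twist_hom 1%g psi = psi.
Proof.
by apply: algebra_hom_inj => x; rewrite -[x]twist_map1 twist_homE !twist_map1.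
Qed.

Definition twist_functor g : endofunctor cat :=
  @Endofunctor cat (fun X => X) (fun X Y => @twist_hom g X Y)
    (fun X => twist_hom_id g X) (fun X Y Z => @twist_hom_comp g X Y Z).

Lemma twist_functorM g h :
  twist_functor (g * h)%g = (twist_functor g * twist_functor h)%g.
Proof.
apply: (@eq_endofunctor_id cat) => X Y f; exact: twist_homM.
Qed.

Lemma twist_functor1 : twist_functor 1%g = 1%g.
Proof.
apply: (@eq_endofunctor_id cat) => X Y f; exact: twist_hom1.
Qed.

Lemma twist_functorV g : (twist_functor g * twist_functor g^-1 = 1)%g.
Proof. by rewrite -twist_functorM mulgV twist_functor1. Qed.

Lemma twist_functorVg g : (twist_functor g^-1 * twist_functor g = 1)%g.
Proof. by rewrite -twist_functorM mulVg twist_functor1. Qed.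

Definition twist_aut g : category_aut cat :=
  UnitOf (twist_functorV g) (twist_functorVg g).

Lemma twist_autM g h : twist_aut (g * h)%g = (twist_aut g * twist_aut h)%g.
Proof. by apply: unit_inj; apply: twist_functorM. Qed.

End TwistAutomorphism.

(** * Natural bijections are scalars *)

Section StandardObjects.
Local Open Scope fset_scope.

Definition obj1 : {fset nat} := [fset 0%N].
Definition obj2 : {fset nat} := [fset 0%N; 1%N].
Definition point : obj1 := [` fset11 0%N].
Definition left_point : obj2 := [` fset21 0%N 1%N].
Definition right_point : obj2 := [` fset22 0%N 1%N].

Lemma obj1P (v : obj1) : v = point.
Proof. by apply/val_inj/eqP; rewrite -in_fset1 (valP v). Qed.

Lemma obj2P (v : obj2) : v = left_point \/ v = right_point.
Proof.
by have /fset2P[e|e] := valP v; [left|right]; apply: val_inj.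
Qed.

Lemma left_neq_right : left_point != right_point.
Proof. by []. Qed.

End StandardObjects.

Section Center.
Variable k : fieldType.
Local Notation F := (fun X : {fset nat} => free_pa k X).
Local Notation gen := (free_gen k).

Definition at_point (V : Type) (u : free_pa k V) : algebra_hom (F obj1) (free_pa k V) :=
  subst_hom (fun=> u).

Lemma at_point_gen V (u : free_pa k V) v : at_point u (gen v) = u.
Proof. exact: subst_hom_gen. Qed.

Lemma at_point_ext V (f g : algebra_hom (F obj1) (free_pa k V)) :
  f (gen point) = g (gen point) -> f = g.
Proof.
by move=> fg; apply: algebra_hom_inj; apply: free_hom_ext => v; rewrite (obj1P v).
Qed.

Lemma free_gen_neq0 (V : Type) (i : V) : gen i != 0.
Proof.
by apply/eqP => gi0; have := free_gen_sqr_neq0 k i; rewrite gi0 amul0l eqxx.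
Qed.

Lemma scale_gen_inj (V : Type) (i : V) (a b : k) :
  a *: gen i = b *: gen i -> a = b.
Proof.
move/eqP; rewrite -subr_eq0 -scalerBl scaler_eq0 (negPf (free_gen_neq0 i)) orbF.
by rewrite subr_eq0 => /eqP.
Qed.

(** By naturality r is substitution into the image of the generator x, that is r(u) = r(x)(u). As
    r(w) = x, substituting w into r(x) gives x, and [subst_inv_linear] makes r(x) a multiple of
    x. *)
Lemma natural_scalar (r : forall X, F X -> F X) :
  (exists w, r obj1 w = gen point) ->
  (forall X Y (psi : algebra_hom (F X) (F Y)) u, r Y (psi u) = psi (r X u)) ->
  exists2 d, d != 0 & forall X u, r X u = d *: u.
Proof.
move=> [w rw] r_nat.
have [|d d0 ed] := @subst_inv_linear k obj1 point obj1P w (r obj1 (gen point)).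
  by rewrite -[LHS](r_nat _ _ (at_point w)) at_point_gen.
exists d => // X u; rewrite -[in LHS](at_point_gen u point) r_nat ed.
by rewrite algebra_homZ at_point_gen.
Qed.

End Center.

Section TwistInjective.
Variable k : fieldType.
Hypothesis k2 : 2 != 0 :> k.
Local Notation G := (semidirect (natural_action k)).
Implicit Types g h : G.

Lemma twist_group_eq1 g :
  twist_scalar g = 1 -> (forall l, twist_field g l = l) -> g = 1%g.
Proof.
case: g => [c phi] /= c1 phi1; congr Semidirect; apply: unit_inj => //.
exact: rmorph_inj.
Qed.

(** If s makes the twist inner, S^-1 s commutes with all homomorphisms and is a scalar d. It is also
    a twisted map with the parameters of g^-1, and a nonzero scalar can only be one with trivial
    parameters. *)
Lemma twist_aut_inner g : inner (twist_aut k2 g) -> g = 1%g.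
Proof.
move=> [s [s_iso s_nat]].
pose r X u := twist_map g^-1%g (s X u).
have sE (X Y : {fset nat}) (psi : algebra_hom (free_pa k X) (free_pa k Y)) u :
    twist_hom g psi (s X u) = s Y (psi u).
  exact: (congr1 (fun f => algebra_hom_fun f u) (s_nat X Y psi)).
have [|X Y psi u|d d0 rE] := @natural_scalar k r.
- have [t [_ st]] := s_iso obj1.
  exists (t (twist_map g (free_gen k point))); rewrite /r.
  have := congr1 (fun f => algebra_hom_fun f (twist_map g (free_gen k point))) st.
  by move=> /= ->; rewrite twist_mapK.
- rewrite /r -sE; move: (s X u : free_pa k X) => v.
  by rewrite -{1}(twist_mapVK k2 g v) twist_homE // twist_mapK.
have [rD rZ rM] : twisted (twist_scalar g^-1%g) (twist_field g^-1%g) (r obj2).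
  apply: (@twisted_comp_group k k2 _ 1%g) (twist_mapP k2 _ _).
    by rewrite mulg1.
  by apply/twisted_group1P => //; exists (s obj2).
suff : g^-1%g = 1%g by move=> /(congr1 (fun g => g^-1)%g); rewrite invgK invg1.
apply: twist_group_eq1 => [|l].
(* Comparing the coefficients of yx gives d^2 (1 - c)/2 = 0, hence c = 1. *)
- have := rM (free_gen k left_point) (free_gen k right_point).
  rewrite !rE /twisted_mul !amulZl !amulZr !scalerA.
  set c := twist_scalar _; set xy := (_ * _)%g; set yx := (free_gen k right_point * _)%g.
  move=> /eqP; rewrite -subr_eq0 opprD addrA -scalerBl -scaleNr => /eqP.
  case/(free_gens_mul_free left_neq_right) => _ /eqP.
  rewrite oppr_eq0 !mulf_eq0 invr_eq0 (negPf k2) (negPf d0) !orbF subr_eq0.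
  by move/eqP.
- have := rZ l (free_gen k left_point); rewrite !rE !scalerA => e.
  by apply: (mulIf d0); rewrite -(scale_gen_inj e) mulrC.
Qed.

End TwistInjective.

(** * Natural bijections fixing the generators *)

Section ConjScalar.
Variable k : fieldType.
Local Notation F := (fun X : {fset nat} => free_pa k X).
Variables s t : forall X, F X -> F X.
Hypothesis st : forall X, cancel (@t X) (@s X).
Hypothesis ts : forall X, cancel (@s X) (@t X).
Hypothesis s_full : forall X Y (psi' : algebra_hom (F X) (F Y)),
  exists psi : algebra_hom (F X) (F Y), forall u, psi' (s u) = s (psi u).

(** By [s_full] each homomorphism is an s-conjugate of a homomorphism, which commutes with
    multiplication by l; so u -> s(l t(u)) is natural. *)
Lemma conj_scalar l : l != 0 ->
  exists2 d, d != 0 & forall X (u : F X), s (l *: u) = d *: s u.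
Proof.
move=> l0; have [||d d0 rE] := @natural_scalar k (fun X u => s (l *: t u)).
- exists (s (l^-1 *: t (free_gen k point))).
  by rewrite ts scalerA divff // scale1r st.
- move=> X Y psi' u; have [psi psiE] := s_full psi'.
  by rewrite -{1}[u]st psiE ts psiE algebra_homZ.
by exists d => // X u; rewrite -rE ts.
Qed.

End ConjScalar.

Section AtPair.
Variables (k : fieldType) (V : Type).
Implicit Types u v : free_pa k V.
Local Notation F := (fun X : {fset nat} => free_pa k X).
Local Notation lp := (free_gen k left_point).
Local Notation rp := (free_gen k right_point).

Definition at_pair u v : algebra_hom (F obj2) (free_pa k V) :=
  subst_hom (fun i => if i == left_point then u else v).

Lemma at_pair_left u v : at_pair u v lp = u.
Proof. exact: subst_hom_gen. Qed.

Lemma at_pair_right u v : at_pair u v rp = v.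
Proof. exact: subst_hom_gen. Qed.

Lemma at_pair_ext (f g : algebra_hom (F obj2) (free_pa k V)) :
  f lp = g lp -> f rp = g rp -> f = g.
Proof.
move=> fl fr; apply: algebra_hom_inj; apply: free_hom_ext => v.
by case: (obj2P v) => ->.
Qed.

End AtPair.

Section NaturalBijection.
Variable k : fieldType.
Hypothesis char_k0 : [pchar k] =i pred0.
Local Notation F := (fun X : {fset nat} => free_pa k X).
Variables s t : forall X, F X -> F X.
Hypothesis st : forall X, cancel (@t X) (@s X).
Hypothesis ts : forall X, cancel (@s X) (@t X).
Hypothesis s_gen : forall (X : {fset nat}) (v : X), s (free_gen k v) = free_gen k v.
Hypothesis s_nat : forall X Y (psi : algebra_hom (F X) (F Y)),
  exists psi' : algebra_hom (F X) (F Y), forall u, psi' (s u) = s (psi u).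
Hypothesis s_full : forall X Y (psi' : algebra_hom (F X) (F Y)),
  exists psi : algebra_hom (F X) (F Y), forall u, psi' (s u) = s (psi u).

Local Notation lp := (free_gen k left_point).
Local Notation rp := (free_gen k right_point).

(** The conjugate of the zero homomorphism is constantly s(0), and as a homomorphism it sends 0 to
    0. *)
Lemma natural_zero X : s (0 : F X) = 0.
Proof.
have [psi' psiE] := s_nat (zero_hom (F X) (F X)).
by rewrite -[RHS](algebra_hom0 psi') -[in RHS](st 0) psiE.
Qed.

Lemma natural_scale :
  exists phi : k -> k, forall l X (u : F X), s (l *: u) = phi l *: s u.
Proof.
suff /choice[phi phiP] : forall l, exists d, forall X (u : F X), s (l *: u) = d *: s u.
  by exists phi.
move=> l; have [->|l0] := eqVneq l 0.
  by exists 0 => X u; rewrite !scale0r natural_zero.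
by have [d _ dP] := conj_scalar st ts s_full l0; exists d.
Qed.

(** This is [conj_scalar] for the inverse bijection [t], for which [s_nat] supplies the fullness
    hypothesis. It makes the scalar map of [natural_scale] onto. *)
Lemma natural_unscale d : exists l, forall X (u : F X), s (l *: u) = d *: s u.
Proof.
have [->|d0] := eqVneq d 0.
  by exists 0 => X u; rewrite !scale0r natural_zero.
have [X Y psi'|l _ lP] := @conj_scalar k t s ts st _ d d0; last first.
  by exists l => X u; rewrite -{1}[u]ts -lP st.
have [psi psiE] := s_nat psi'; exists psi => u.
by apply: (can_inj (@ts Y)); rewrite st -psiE st.
Qed.

(* [w] is an operation of two variables; [s] turns it into the operation [s w]. *)
Lemma natural_word X (u v : F X) w :
  s (at_pair u v w) = at_pair (s u) (s v) (s w).
Proof.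
have [psi' psiE] := s_nat (at_pair u v).
rewrite -psiE; congr (algebra_hom_fun _ _); apply: at_pair_ext.
  by rewrite at_pair_left -{1}s_gen psiE at_pair_left.
by rewrite at_pair_right -{1}s_gen psiE at_pair_right.
Qed.

(** Choose l that s turns into 2. Scaling the generators by l multiplies w by l ^+ n; applying s,
    scaling them by 2 multiplies s(w) by 2 ^+ n, and this eigenvalue reveals the degree. *)
Lemma natural_homog n w : homog n w -> homog n (s w : F obj2).
Proof.
move=> wP; apply: homog_of_scale_gens => //.
have [l lP] := natural_unscale 2.
have lXP m X (u : F X) : s (l ^+ m *: u) = 2 ^+ m *: s u.
  elim: m u => [|m IH] u; first by rewrite !scale1r.
  by rewrite !exprSr -!scalerA IH lP.
have scaleE a : @scale_gens k obj2 a = at_pair (a *: lp) (a *: rp).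
  by apply: at_pair_ext; rewrite ?at_pair_left ?at_pair_right; apply: subst_hom_gen.
by rewrite scaleE -[lp]s_gen -[rp]s_gen -!lP -natural_word -scaleE
  (scale_gens_homog _ wP) lXP.
Qed.

Lemma natural_add X (u v : F X) : s (u + v) = s u + s v.
Proof.
have hw : homog 1 (s (lp + rp)).
  exact/natural_homog/homogD/homog_gen/homog_gen.
have [a [b wE]] := homog1_lin obj2P hw erefl.
have sE Y (x y : F Y) : s (x + y) = a *: s x + b *: s y.
  have -> : x + y = at_pair x y (lp + rp).
    by rewrite algebra_homD at_pair_left at_pair_right.
  rewrite natural_word wE algebra_homD !algebra_homZ.
  by rewrite at_pair_left at_pair_right.
(* Setting one variable to 0 isolates each coefficient. *)
have a1 : a = 1.
  apply: (@scale_gen_inj k _ point); rewrite scale1r.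
  by have := sE _ (free_gen k point) 0; rewrite addr0 natural_zero scaler0 addr0 !s_gen => <-.
have b1 : b = 1.
  apply: (@scale_gen_inj k _ point); rewrite scale1r.
  by have := sE _ 0 (free_gen k point); rewrite add0r natural_zero scaler0 add0r !s_gen => <-.
by rewrite sE a1 b1 !scale1r.
Qed.

(** The two inequalities reflect injectivity of s: b + c = 0 would give s(xx) = 0, and b = c would
    give s(xy) = s(yx). They make (b - c)/(b + c) a unit. *)
Lemma natural_mul : exists b c : k, [/\ b + c != 0, b - c != 0 &
  forall X (u v : F X), s (u * v)%g = b *: (s u * s v)%g + c *: (s v * s u)%g].
Proof.
have hw : homog 2 (s (lp * rp)%g).
  exact/natural_homog/(homogM (homog_gen _ _) (homog_gen _ _)).
have [a [b [c [d wE]]]] := homog2_quad obj2P hw erefl.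
have {wE} sE Y (x y : F Y) : s (x * y)%g =
    a *: (s x * s x)%g + b *: (s x * s y)%g + (c *: (s y * s x)%g + d *: (s y * s y)%g).
  have -> : (x * y)%g = at_pair x y (lp * rp)%g.
    by rewrite algebra_homM at_pair_left at_pair_right.
  rewrite natural_word wE !algebra_homD !algebra_homZ !algebra_homM.
  by rewrite at_pair_left at_pair_right.
have sqr0 l : l *: (free_gen k point * free_gen k point)%g = 0 -> l = 0.
  by move/eqP; rewrite scaler_eq0 (negPf (free_gen_sqr_neq0 _ _)) orbF => /eqP.
(* The square terms disappear on setting the other variable to 0. *)
have a0 : a = 0.
  apply: sqr0; have := sE _ (free_gen k point) 0.
  by rewrite !(amul0r, amul0l, natural_zero) !scaler0 !addr0 s_gen => <-.
have d0 : d = 0.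
  apply: sqr0; have := sE _ 0 (free_gen k point).
  by rewrite !(amul0r, amul0l, natural_zero) !scaler0 !add0r s_gen => <-.
exists b, c; split=> [||X u v]; last by rewrite sE a0 d0 !scale0r addr0 add0r.
- apply: contra (free_gen_sqr_neq0 k point) => /eqP bc.
  rewrite -(inj_eq (can_inj (@ts obj1))) sE a0 d0 !scale0r addr0 add0r natural_zero.
  by rewrite -scalerDl bc scale0r.
- apply/eqP => /subr0_eq bc.
  have /(can_inj (@ts obj2)) e : s (lp * rp)%g = s (rp * lp)%g.
    by rewrite !sE a0 d0 !scale0r !addr0 !add0r bc addrC.
  have [] := @free_gens_mul_free k obj2 _ _ 1 (-1) left_neq_right.
    by rewrite e scale1r scaleN1r subrr.
  by move/eqP; rewrite oner_eq0.
Qed.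

Lemma natural_twist : exists (g : semidirect (natural_action k)) (d : k), d != 0 /\
  forall X, twisted (twist_scalar g) (twist_field g) (fun u : F X => d *: s u).
Proof.
have k2 : 2 != 0 :> k by rewrite ((pcharf0P k).1 char_k0 2%N).
have [phi0 phiP] := natural_scale.
have /choice[psi0 psiP] := natural_unscale.
have [b [c [bc0 bc1 sM]]] := natural_mul.
have phi_eq l m : s (l *: lp) = m *: lp -> phi0 l = m.
  by rewrite phiP s_gen; apply: scale_gen_inj.
have phiD : zmod_morphism phi0.
  move=> l m; apply: phi_eq; rewrite scalerBl; apply: (addIr (s (m *: lp))).
  by rewrite -natural_add subrK !phiP s_gen -scalerDl subrK.
have phiM : monoid_morphism phi0.
  split=> [|l m]; first by apply: phi_eq; rewrite !scale1r s_gen.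
  by apply: phi_eq; rewrite -scalerA !phiP s_gen scalerA.
pose phi : {rmorphism k -> k} := HB.pack phi0
  (GRing.isZmodMorphism.Build _ _ phi0 phiD) (GRing.isMonoidMorphism.Build _ _ phi0 phiM).
have phiK d : phi (psi0 d) = d by apply: phi_eq; rewrite psiP s_gen.
have psiK l : psi0 (phi l) = l by apply: (fmorph_inj phi); rewrite phiK.
have psiD : zmod_morphism psi0.
  by move=> l m; apply: (fmorph_inj phi); rewrite rmorphB !phiK.
have psiM : monoid_morphism psi0.
  split=> [|l m]; first by apply: (fmorph_inj phi); rewrite phiK rmorph1.
  by apply: (fmorph_inj phi); rewrite rmorphM !phiK.
pose psi : {rmorphism k -> k} := HB.pack psi0
  (GRing.isZmodMorphism.Build _ _ psi0 psiD) (GRing.isMonoidMorphism.Build _ _ psi0 psiM).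
have phi_psi : ((phi : ring_endo k) * (psi : ring_endo k) = 1)%g.
  by apply: rmorph_inj => l; apply: phiK.
have psi_phi : ((psi : ring_endo k) * (phi : ring_endo k) = 1)%g.
  by apply: rmorph_inj => l; apply: psiK.
(* This e solves (1 + e)/2 = b/(b + c) and (1 - e)/2 = c/(b + c), the coefficients of the product
   after s is multiplied by b + c. *)
pose e := (b - c) / (b + c).
have e0 : e != 0 by rewrite mulf_neq0 ?invr_eq0.
pose a : scalar_group k := @UnitOf (mult_monoid k) e (e^-1)%R (mulfV e0) (mulVf e0).
pose f : field_aut k := UnitOf phi_psi psi_phi.
pose g : semidirect (natural_action k) := Semidirect (natural_action k) a f.
exists g, (b + c); split=> // X; split=> [u v|l u|u v].
- by rewrite natural_add scalerDr.
- by rewrite phiP !scalerA mulrC.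
- rewrite sM /twisted_mul !amulZl !amulZr scalerDr !scalerA.
  have -> : twist_scalar g = e by [].
  by congr (_ *: _ + _ *: _); rewrite /e; field; rewrite ?bc0 ?k2.
Qed.

End NaturalBijection.

(** * Automorphisms of the category and objects of rank one *)

Section CategoryAut.
Variables (C : category) (U : category_aut C).
Local Notation UF := (unit_val U).
Local Notation UG := (unit_inv U).

Let UFG : functor_comp UF UG = functor_id C. Proof. exact: (unit_valV U). Qed.
Let UGF : functor_comp UG UF = functor_id C. Proof. exact: (unit_Vval U). Qed.

Lemma category_aut_obj_surj (X : obj C) : exists Y, fobj UF Y = X.
Proof. by exists (fobj UG X); apply: (congr1 (fun K => fobj K X) UFG). Qed.

(** The hom types depend on the functor, so the equality is used by substituting for a variable K;
    the composites with the inverse are then instances. *)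
Lemma functor_id_faithful (K : endofunctor C) : K = functor_id C ->
  forall (X Y : obj C), injective (@fmor C K X Y).
Proof. by move=> -> X Y f g. Qed.

Lemma functor_id_full (K : endofunctor C) : K = functor_id C ->
  forall (X Y : obj C) (f : Defs.hom (fobj K X) (fobj K Y)), exists g, fmor K g = f.
Proof. by move=> -> X Y f; exists f. Qed.

Lemma category_aut_faithful (X Y : obj C) : injective (@fmor C UF X Y).
Proof.
move=> f g e; apply: (functor_id_faithful UGF); exact: (congr1 (@fmor C UG _ _) e).
Qed.

Lemma category_aut_full (X Y : obj C) (f : Defs.hom (fobj UF X) (fobj UF Y)) :
  exists g, fmor UF g = f.
Proof.
have [g gE] := functor_id_full UGF (fmor UG f); exists g.
by apply: (functor_id_faithful UFG); apply: (congr1 (@fmor C UF _ _) gE).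
Qed.

Definition retract (X Y : obj C) : Prop :=
  exists (i : Defs.hom X Y) (p : Defs.hom Y X), Defs.comp p i = idc X.

Lemma category_aut_retract (X Y : obj C) :
  retract X Y <-> retract (fobj UF X) (fobj UF Y).
Proof.
split=> [[i [p pi]]|[i [p pi]]].
  by exists (fmor UF i), (fmor UF p); rewrite -fmor_comp pi fmor_id.
have [i' i'E] := category_aut_full i; have [p' p'E] := category_aut_full p.
exists i', p'; apply: category_aut_faithful.
by rewrite fmor_comp i'E p'E pi fmor_id.
Qed.

Definition least_object (X : obj C) : Prop := forall Y, retract X Y.

Definition atomic_object (X : obj C) : Prop :=
  ~ least_object X /\ forall Y, ~ least_object Y -> retract X Y.

Lemma category_aut_least (X : obj C) : least_object (fobj UF X) <-> least_object X.
Proof.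
split=> leX Y; first exact: (category_aut_retract X Y).2 (leX _).
by have [Z <-] := category_aut_obj_surj Y; apply: (category_aut_retract X Z).1 (leX Z).
Qed.

Lemma category_aut_atomic (X : obj C) : atomic_object X -> atomic_object (fobj UF X).
Proof.
move=> [nleX atX]; split=> [/category_aut_least//|Y].
have [Z <-] := category_aut_obj_surj Y => nleZ.
by apply: (category_aut_retract X Z).1; apply: atX => /category_aut_least.
Qed.

End CategoryAut.

Lemma coset_proj_natural_iso (C : category) (U V : category_aut C) :
  coset_proj (inner_auts C) U = coset_proj (inner_auts C) V <->
  natural_iso (unit_val U) (unit_val V).
Proof.
rewrite coset_projP inE; split=> [/asboolP innUV|UV].
  have := natural_iso_comp (natural_iso_refl (unit_val U)) innUV.
  by rewrite mulg1 mulgA unit_valV mul1g.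
apply/asboolP; have := natural_iso_comp (natural_iso_refl (unit_inv U)) UV.
by rewrite unit_Vval.
Qed.

Section AtomicObjects.
Variable k : fieldType.
Local Notation cat := (free_pa_category k).

(** A least object is a retract of F of the empty set, which is 0, whereas generators are
    nonzero. *)
Lemma least_object_empty (X : {fset nat}) : @least_object cat X <-> (X -> False).
Proof.
split=> [leX v|X0 Y].
  have [i [p pi]] := leX (fset0 : {fset nat}).
  have zero0 (x : free_pa k (fset0 : {fset nat})) : x = 0.
    apply: (free_hom_ext (f := algebra_hom_id _) (g := zero_hom _ _)) => w.
    by have := valP w; rewrite in_fset0.
  have := congr1 (fun f => algebra_hom_fun f (free_gen k v)) pi.
  rewrite /= [algebra_hom_fun i _]zero0 algebra_hom0 => e.
  by have := free_gen_neq0 k v; rewrite -e eqxx.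
exists (zero_hom _ _), (zero_hom _ _).
apply: algebra_hom_inj; apply: free_hom_ext => v; by case: (X0 v).
Qed.

Lemma atomic_obj1 : @atomic_object cat obj1.
Proof.
split=> [/least_object_empty /(_ point)//|Y].
have [[v _]|Y0] := pselect (exists v : Y, True); last first.
  by case; apply/least_object_empty => v; apply: Y0; exists v.
move=> _; exists (at_point (free_gen k v)), (subst_hom (fun=> free_gen k point)).
apply: at_point_ext; apply: etrans (subst_hom_gen (fun _ : Y => free_gen k point) v).
exact: congr1 (at_point_gen (free_gen k v) point).
Qed.

(** Such an object is a retract of F(x), hence commutative, while two distinct generators do not
    commute. *)
Lemma atomic_object_singleton (X : {fset nat}) :
  @atomic_object cat X -> exists v : X, forall w, w = v.
Proof.
move=> [nleX /(_ obj1 (proj1 atomic_obj1))[i [p pi]]].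
have [[v _]|X0] := pselect (exists v : X, True); last first.
  by case: nleX; apply/least_object_empty => v; apply: X0; exists v.
exists v => w; apply/eqP/negPn/negP => vw.
have piE x : p (i x) = x by apply: (congr1 (fun f => algebra_hom_fun f x) pi).
have mulC (x y : free_pa k X) : (x * y)%g = (y * x)%g.
  by rewrite -[x]piE -[y]piE -!(algebra_homM p) (free_one_gen_mulC obj1P).
have [|] := @free_gens_mul_free k X w v 1 (-1) vw.
  by rewrite mulC scale1r scaleN1r subrr.
by move/eqP; rewrite oner_eq0.
Qed.

End AtomicObjects.

(** * Every automorphism is a twist up to inner ones *)

Section TwistSurjective.
Variable k : fieldType.
Hypothesis char_k0 : [pchar k] =i pred0.
Hypothesis k2 : 2 != 0 :> k.
Local Notation cat := (free_pa_category k).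
Local Notation F := (fun X : {fset nat} => free_pa k X).
Variable U : category_aut cat.

Definition aut_obj (X : {fset nat}) : {fset nat} := fobj (unit_val U) X.
Definition aut_mor (X Y : {fset nat}) (psi : algebra_hom (F X) (F Y)) :
  algebra_hom (F (aut_obj X)) (F (aut_obj Y)) := @fmor cat (unit_val U) X Y psi.

Lemma aut_mor_comp X Y Z (psi : algebra_hom (F Y) (F Z)) (chi : algebra_hom (F X) (F Y)) u :
  aut_mor (algebra_hom_comp psi chi) u = aut_mor psi (aut_mor chi u).
Proof.
exact: (congr1 (fun f => algebra_hom_fun f u)
  (@fmor_comp cat (unit_val U) X Y Z psi chi)).
Qed.

Lemma aut_mor_full X Y (f : algebra_hom (F (aut_obj X)) (F (aut_obj Y))) :
  exists g, aut_mor g = f.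
Proof. exact: (@category_aut_full cat U X Y f). Qed.

Lemma aut_mor_faithful X Y (f g : algebra_hom (F X) (F Y)) :
  aut_mor f = aut_mor g -> f = g.
Proof. exact: (@category_aut_faithful cat U X Y). Qed.

Lemma aut_obj_surj X : exists Y, aut_obj Y = X.
Proof. exact: (@category_aut_obj_surj cat U X). Qed.

(* Elements of [F X] are the morphisms [F obj1 -> F X], and [aut_obj obj1] has a
   single generator as well. *)
Lemma transport_points : exists (s : forall X, F X -> F (aut_obj X))
    (t : forall X, F (aut_obj X) -> F X),
  [/\ forall X, cancel (s X) (t X), forall X, cancel (t X) (s X) &
      forall X Y (psi : algebra_hom (F X) (F Y)) u, aut_mor psi (s X u) = s Y (psi u)].
Proof.
have [v0 v0P] := atomic_object_singleton (category_aut_atomic U (atomic_obj1 k)).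
rewrite -/(aut_obj obj1) in v0 v0P.
(* An element u is read as the morphism x -> u, the automorphism is applied, and the result is
   evaluated at the only generator of the image of F(x). *)
pose s X (u : F X) : F (aut_obj X) := aut_mor (at_point u) (free_gen k v0).
have s_nat X Y (psi : algebra_hom (F X) (F Y)) u : aut_mor psi (s X u) = s Y (psi u).
  rewrite /s -aut_mor_comp; congr (algebra_hom_fun (aut_mor _) _).
  apply: at_point_ext; rewrite at_point_gen.
  exact: congr1 (at_point_gen u point).
have s_inj X : injective (s X).
  move=> u v; rewrite /s => e.
  have /aut_mor_faithful : aut_mor (at_point u) = aut_mor (at_point v).
    by apply: algebra_hom_inj; apply: free_hom_ext => w; rewrite (v0P w).
  move=> /(congr1 (fun f => algebra_hom_fun f (free_gen k point))).
  by rewrite !at_point_gen.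
have s_surj X v : exists u, s X u = v.
  have [f fE] := aut_mor_full (subst_hom (fun _ : aut_obj obj1 => v)).
  exists (f (free_gen k point)); rewrite /s.
  rewrite (_ : at_point _ = f) ?fE ?subst_hom_gen //.
  by apply: at_point_ext; rewrite at_point_gen.
pose t X v := projT1 (cid (s_surj X v)).
have ts X : cancel (t X) (s X) by move=> v; apply: (projT2 (cid (s_surj X v))).
by exists s, t; split=> // X u; apply: s_inj; rewrite ts.
Qed.

Section Transport.
Variables (s : forall X, F X -> F (aut_obj X)) (t : forall X, F (aut_obj X) -> F X).
Hypothesis st : forall X, cancel (@s X) (@t X).
Hypothesis ts : forall X, cancel (@t X) (@s X).
Hypothesis s_nat : forall X Y (psi : algebra_hom (F X) (F Y)) u,
  aut_mor psi (s u) = s (psi u).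

(** Identifies F(X) with its image under U so that s becomes a bijection of F(X) fixing the
    generators. *)
Lemma transport_free X :
  exists (b : algebra_hom (F X) (F (aut_obj X))) (c : algebra_hom (F (aut_obj X)) (F X)),
  [/\ cancel b c, cancel c b & forall v, b (free_gen k v) = s (free_gen k v)].
Proof.
(* With X in the form U(Z), a homomorphism psi into F(Z) sending generators to their t-images has
   U(psi) as a left inverse of b. *)
have [Z <-] := aut_obj_surj X.
pose b : algebra_hom (F (aut_obj Z)) (F (aut_obj (aut_obj Z))) :=
  subst_hom (fun v => s (free_gen k v)).
have bE v : b (free_gen k v) = s (free_gen k v) by apply: subst_hom_gen.
pose psi : algebra_hom (F (aut_obj Z)) (F Z) := subst_hom (fun v => t (free_gen k v)).
have psiE v : psi (free_gen k v) = t (free_gen k v) by apply: subst_hom_gen.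
have cb : cancel b (aut_mor psi).
  apply: (free_hom_ext (f := algebra_hom_comp (aut_mor psi) b) (g := algebra_hom_id _)) => v.
  by rewrite [LHS](congr1 _ (bE v)) s_nat psiE ts.
(* Fullness writes b as U(rho); then rho psi = id on generators makes U(psi) a right inverse too. *)
have [rho rhoE] := aut_mor_full b.
have rho_psi x : rho (psi x) = x.
  apply: (free_hom_ext (f := algebra_hom_comp rho psi) (g := algebra_hom_id _)) => v /=.
  apply: (can_inj (@st _)); rewrite -(s_nat rho) -(s_nat psi) rhoE.
  transitivity (b (aut_mor psi (b (free_gen k v)))).
    by rewrite (bE v).
  exact: etrans (congr1 b (cb _)) (bE v).
exists b, (aut_mor psi); split=> // x.
have := aut_mor_comp rho psi x; rewrite rhoE => <-.
rewrite -[x]ts s_nat; congr s.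
exact: rho_psi.
Qed.

Lemma transport_twist : exists g, natural_iso (twist_functor k2 g) (unit_val U).
Proof.
pose bc X := cid (transport_free X).
pose b X := projT1 (bc X); pose c X := projT1 (cid (projT2 (bc X))).
have bcP X : [/\ cancel (b X) (c X), cancel (c X) (b X) &
    forall v, b X (free_gen k v) = s (free_gen k v)].
  exact: projT2 (cid (projT2 (bc X))).
have bK X : cancel (b X) (c X) by case: (bcP X).
have cK X : cancel (c X) (b X) by case: (bcP X).
have bE X v : b X (free_gen k v) = s (free_gen k v) by case: (bcP X).
(* The composite of s with the inverse of b fixes generators, so [natural_twist] applies to it. *)
have [X u|X u|X v|X Y psi|X Y psi'|g [d [d0 tw]]] :=
    @natural_twist k char_k0 (fun X u => c X (s u)) (fun X u => t (b X u)).
- by rewrite ts bK.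
- by rewrite cK st.
- by rewrite -bE bK.
- exists (algebra_hom_comp (c Y) (algebra_hom_comp (aut_mor psi) (b X))) => u /=.
  by rewrite cK s_nat.
- have [psi psiE] := aut_mor_full (algebra_hom_comp (b Y) (algebra_hom_comp psi' (c X))).
  by exists psi => u; rewrite -s_nat psiE /= bK.
exists g.
pose r X (u : F X) := d *: s u.
pose r' X (v : F (aut_obj X)) : F X := t (d^-1 *: v).
have rK X : cancel (@r X) (@r' X).
  by move=> u; rewrite /r /r' scalerA mulVf // scale1r st.
have r'K X : cancel (@r' X) (@r X).
  by move=> u; rewrite /r /r' ts scalerA divff // scale1r.
have tw_r X : twisted (twist_scalar g) (twist_field g) (@r X).
  have rE : @r X = b X \o (fun u => d *: c X (s u)).
    by apply: funext => u; rewrite /= algebra_homZ cK.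
  rewrite rE; apply: (twisted_comp_group k2 (esym (mul1g g)) (tw X)).
  by apply/twisted_group1P => //; exists (b X).
(* In d s S^-1 the parameters of g and g^-1 cancel, leaving a genuine homomorphism; it is natural
   because S^-1 and s intertwine the morphisms and d commutes with them. *)
have tau_ex X : exists f : algebra_hom (F X) (F (aut_obj X)),
    f =1 r X \o @twist_map k g^-1%g X.
  apply/(twisted_group1P k2); apply: (twisted_comp_group k2 _ _ (tw_r X)).
    by rewrite -(mulgV g).
  exact: twist_mapP.
pose tau X := projT1 (cid (tau_ex X)).
have tauE X u : tau X u = r X (twist_map g^-1%g u) by exact: projT2 (cid (tau_ex X)) u.
exists tau; split=> [X|X Y psi].
- have tauK : cancel (tau X) (fun v => twist_map g (r' X v)).
    by move=> u; rewrite tauE rK twist_mapVK.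
  have tauK' : cancel (fun v => twist_map g (r' X v)) (tau X).
    by move=> u; rewrite tauE twist_mapK // r'K.
  have [h hE] := algebra_hom_bij_inv tauK tauK'.
  exists h; split; apply: algebra_hom_inj => u /=.
    by rewrite hE tauK.
  by rewrite hE tauK'.
- apply: algebra_hom_inj => u.
  change (aut_mor psi (tau X u) = tau Y (twist_hom g psi u)).
  rewrite !tauE -{2}[u](twist_mapVK k2 g) twist_homE // twist_mapK // /r.
  by rewrite algebra_homZ s_nat.
Qed.

End Transport.

Lemma twist_surjective : exists g, natural_iso (twist_functor k2 g) (unit_val U).
Proof. by have [s [t [st ts s_nat]]] := transport_points; apply: transport_twist s_nat. Qed.

End TwistSurjective.

(** * The isomorphism of groups *)

Theorem theorem4p1 (k : fieldType) (char_k0 : ([pchar k] =i pred0)%R) :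
  isomorphic_groups
    (quotient_group (inner_auts (free_pa_category k)))
    (semidirect (natural_action k)).
Proof.
have k2 : 2 != 0 :> k by rewrite ((pcharf0P k).1 char_k0 2%N).
pose N := inner_auts (free_pa_category k).
(* The map from pairs to classes of twists is built first; the required isomorphism is its
   inverse. *)
pose Phi g : quotient_group N := coset_proj N (twist_aut k2 g).
have PhiM g h : Phi (g * h)%g = (Phi g * Phi h)%g.
  by rewrite /Phi twist_autM; apply/esym; apply: coset_projM.
have Phi_inj : injective Phi.
  move=> g h /coset_projP; rewrite inE => /asboolP.
  have -> : ((twist_aut k2 g)^-1 * twist_aut k2 h = twist_aut k2 (g^-1 * h))%g.
    rewrite twist_autM; congr (_ * _)%g; apply: unit_inj.
    by [].
  by move=> /twist_aut_inner e; rewrite -[h]mul1g -(mulgV g) -mulgA e mulg1.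
have Phi_surj x : exists g, Phi g = x.
  have [U ->] := coset_proj_surj x.
  have [g gU] := twist_surjective char_k0 k2 U.
  by exists g; apply/coset_proj_natural_iso.
pose Psi x := projT1 (cid (Phi_surj x)).
have PsiK : cancel Psi Phi by move=> x; exact: projT2 (cid (Phi_surj x)).
have PhiK : cancel Phi Psi by move=> g; apply: Phi_inj; rewrite PsiK.
have PsiM : {morph Psi : x y / (x * y)%g}.
  by move=> x y; apply: Phi_inj; rewrite PhiM !PsiK.
pose f : {multiplicative quotient_group N -> semidirect (natural_action k)} :=
  HB.pack Psi (isMultiplicative.Build _ _ Psi PsiM).
by exists f, Phi.
Qed.
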